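(* Let $\mathbb{K}$ be a field and $n\geq1$. The Cartan matrix of the annular arc algebra $\mathfrak{A}rc^{\mathrm{ann}}_{n}$ is positive semidefinite with determinant zero.
   Context: The Cartan matrix of a finite-dimensional algebra has rows and columns indexed by isomorphism classes of simple modules $L_i$ and entries the Jordan–Hölder multiplicities $[P_i:L_j]$, with $P_i$ the indecomposable projective with head $L_i$. Diagrams. A weight is $\lambda=(\lambda_1,\dots,\lambda_{2n})\in\{\vee,\wedge\}^{2n}$ with $n$ symbols $\vee$ and $n$ symbols $\wedge$; $X$ is the set of weights. Take an oriented circle $\mathbb{S}^1$ (orientation called ''rightwards'') with vertices $1,\dots,2n$ met in this order inside a segment between two marked points (one before $1$, one after $2n$); the dashed lines are the vertical lines of the cylinder through the marked points. A cup diagram $S$ is a collection of $n$ pairwise non-intersecting arcs smoothly embedded in $\mathbb{S}^1\times[-1,0]$, each with one critical point, whose endpoints are exactly the $2n$ vertices on $\mathbb{S}^1\times\{0\}$, each arc crossing each dashed line transversally and at most once. An arc is of staying type if it stays in the region of the cylinder below the segment containing the vertices, otherwise (going once around the back) of wrapping type. Cup diagrams are identified if their arcs join the same vertices and have the same types. Equivalently: attach to an arc joining $a<b$ the cyclic interval $\{a,\dots,b\}$ if staying and $\{b,\dots,2n,1,\dots,a\}$ if wrapping; a cup diagram is a perfect matching of $\{1,\dots,2n\}$ with a type for each arc such that the intervals of any two arcs are disjoint or nested. The reflection $T^{\star}$ in $\mathbb{S}^1\times[0,1]$ of a cup diagram $T$ is a cap diagram. $S\lambda$ (and $\lambda S^{\star}$)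 is oriented if the two ends of every arc carry different symbols of $\lambda$; $M(\lambda)$ is the set of cup diagrams $S$ with $S\lambda$ oriented. For $S,T\in M(\lambda)$, $C^{\lambda}_{S,T}=S\lambda T^{\star}$ is the oriented circle diagram obtained by gluing $T^{\star}$ on top of $S$ in $\mathbb{S}^1\times[-1,1]$, the strand at vertex $i$ being oriented downwards if $\lambda_i=\vee$ and upwards if $\lambda_i=\wedge$. A circle is essential if it is non-trivial in $\pi_1$ of the cylinder, usual otherwise. In the unrolled picture of the cylinder (rightwards to the right, $[-1,1]$ upwards), a usual circle is anticlockwise or clockwise and an essential circle is leftwards or rightwards. The algebra. As a vector space $\mathfrak{A}rc^{\mathrm{ann}}_{n}$ has basis all oriented circle diagrams $C^{\lambda}_{S,T}$ ($\lambda\in X$, $S,T\in M(\lambda)$). Product: $C^{\lambda}_{S,T}C^{\mu}_{U,V}=0$ if $T\neq U$. If $T=U$, stack $TV^{\star}$ (oriented by $\mu$) on top of $ST^{\star}$ (oriented by $\lambda$), with $T^{\star}T$ in the middle. Repeatedly choose a cap of the middle $T^{\star}$ and its mirror image cup in $T$ which can be connected without crossing other arcs, and replace them by two vertical strands (surgery), reorienting the circles involved by the rules below (other parts keep their orientation). When the middle consists of vertical strands only, collapse it to obtain a linear combination of oriented circle diagrams on $SV^{\star}$. Two circles merge into one: (M.a) if one is usual and anticlockwise, the result gets the orientation (clockwise/anticlockwise/leftwards/rightwards) of the other; (M.b) if one is usual and clockwise and the other is not usual and anticlockwise, the result is $0$; (M.c) if one is essential leftwards and the other essential rightwards, the result is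 oriented clockwise; (M.d) otherwise $0$. One circle splits into two: (S.a) usual anticlockwise into two usual circles $c_1,c_2$: sum of two terms, $c_1$ clockwise and $c_2$ anticlockwise, plus vice versa; (S.b) usual clockwise into two usual: both clockwise; (S.c) usual anticlockwise into two essential circles $c_1,c_2$: sum of two terms, $c_1$ leftwards and $c_2$ rightwards, plus vice versa; (S.d) usual clockwise into two essential: $0$; (S.e) essential into a usual and an essential circle: the usual one is clockwise and the essential one keeps the orientation. This product is independent of choices and makes $\mathfrak{A}rc^{\mathrm{ann}}_{n}$ an associative unital finite-dimensional algebra. *)

(* Defs.v *)
From HB Require Import structures.
From mathcomp Require Import all_boot all_order all_algebra all_field.

Set Implicit Arguments.
Unset Strict Implicit.
Unset Printing Implicit Defensive.

Import Order.TTheory GRing.Theory Num.Theory.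
Local Open Scope ring_scope.

Definition isomorphic (A : nzRingType) (M N : lmodType A) : Prop :=
  exists f : {linear M -> N}, bijective f.

Definition simple_module (A : nzRingType) (L : lmodType A) : Prop :=
  (exists v : L, v != 0) /\
  forall U : {pred L}, submod_closed U -> U =i pred1 0 \/ U =i predT.

Definition maximal_submodule (A : nzRingType) (M : lmodType A) (U : {pred M})
    : Prop :=
  [/\ submod_closed U, ~ U =i predT &
      forall V : {pred M}, submod_closed V -> {subset U <= V} ->
        V =i U \/ V =i predT].

Definition in_radical (A : nzRingType) (M : lmodType A) (x : M) : Prop :=
  forall U : {pred M}, maximal_submodule U -> x \in U.

(* M / rad M is isomorphic to L. *)
Definition has_head (A : nzRingType) (M L : lmodType A) : Prop :=
  exists2 f : {linear M -> L},
    forall y, exists x, f x = y & forall x, f x = 0 <-> in_radical x.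

Definition indecomposable (A : nzRingType) (M : lmodType A) : Prop :=
  (exists v : M, v != 0) /\
  forall U V : {pred M}, submod_closed U -> submod_closed V ->
    (forall x, x \in U -> x \in V -> x = 0) ->
    (forall x, exists u v, [/\ u \in U, v \in V & x = u + v]) ->
    U =i pred1 0 \/ V =i pred1 0.

Definition projective (A : nzRingType) (P : lmodType A) : Prop :=
  forall (M N : lmodType A) (g : {linear M -> N}) (f : {linear P -> N}),
    (forall y, exists x, g x = y) ->
    exists h : {linear P -> M}, forall x, g (h x) = f x.

(* The subquotient U' / U of M is isomorphic to L: a linear surjection from U'
   onto L with kernel U; the values of f outside U' are irrelevant. *)
Definition subquotient_iso (A : nzRingType) (M : lmodType A) (U' U : {pred M})
    (L : lmodType A) : Prop :=
  exists f : M -> L,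
    [/\ forall a u v, u \in U' -> v \in U' -> f (a *: u + v) = a *: f u + f v,
        forall y, exists2 u, u \in U' & f u = y &
        forall u, u \in U' -> (f u = 0 <-> u \in U)].

Definition composition_series (A : nzRingType) (M : lmodType A) (l : nat)
    (U : nat -> {pred M}) : Prop :=
  [/\ U 0%N =i pred1 0, U l =i predT,
      forall k, (k <= l)%N -> submod_closed (U k) &
      forall k, (k < l)%N -> {subset U k <= U k.+1} /\
        exists2 S : lmodType A,
          simple_module S & subquotient_iso (U k.+1) (U k) S].

(* [M : L] = c *)
Definition jh_multiplicity (A : nzRingType) (M L : lmodType A) (c : nat)
    : Prop :=
  exists (l : nat) (U : nat -> {pred M}) (I : {set 'I_l}),
    [/\ composition_series l U,
        forall k : 'I_l, k \in I <-> subquotient_iso (U k.+1) (U k) L &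
        #|I| = c].

(* The Cartan matrix depends on an enumeration of the simple modules up to
   isomorphism; this holds when M is the one of some enumeration. *)
Definition is_cartan_matrix (A : nzRingType) (m : nat) (M : 'M[int]_m) : Prop :=
  exists L P : 'I_m -> lmodType A,
    [/\ forall i, simple_module (L i),
        forall i j, isomorphic (L i) (L j) -> i = j,
        forall S : lmodType A, simple_module S -> exists i, isomorphic S (L i),
        forall i, [/\ indecomposable (P i), projective (P i) &
                      has_head (P i) (L i)] &
        forall i j, exists2 c : nat,
          jh_multiplicity (P i) (L j) c & M i j = c%:Z].

(* Quantifying over all real fields R covers the field of real numbers. *)
Definition positive_semidefinite (m : nat) (M : 'M[int]_m) : Prop :=
  M^T = M /\
  forall (R : realFieldType) (x : 'cV[R]_m),
    0 <= (x^T *m map_mx intr M *m x) 0 0.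

Definition vertex (n : nat) := 'I_(2 * n).

(* An arc is encoded by its (left, right) ends in the unrolled picture: for
   a < b, (a, b) is the staying arc and (b, a) the wrapping arc joining a and
   b, so that going rightwards from the first to the second component runs
   below the arc through its cyclic interval. *)
Definition arc (n : nat) := (vertex n * vertex n)%type.

Definition wrapping n (c : arc n) : bool := (c.2 < c.1)%N.

(* The cyclic interval of c as a subset of the circle: i stands for the segment
   from the vertex i rightwards to the next vertex.  Intervals have to be
   compared as subsets of the circle and not through the vertices they contain:
   the wrapping arcs joining 1, 2 and 3, 4 (n = 2) do intersect, although both
   of their intervals contain all four vertices. *)
Definition interval n (c : arc n) : {set vertex n} :=
  [set i : vertex n | if wrapping c then (c.1 <= i)%N || (i < c.2)%N
                      else (c.1 <= i < c.2)%N].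

Definition is_cup_diagram n (S : {set arc n}) : bool :=
  [&& [forall c in S, c.1 != c.2],
      [forall i : vertex n, #|[set c in S | (i == c.1) || (i == c.2)]| == 1%N] &
      [forall c in S, forall d in S,
         [|| [disjoint interval c & interval d],
             interval c \subset interval d | interval d \subset interval c]]].

(* true is a downwards strand, false an upwards one *)
Definition weight (n : nat) := {ffun vertex n -> bool}.

Definition is_weight n (w : weight n) : bool := #|[set i | w i]| == n.

Definition oriented n (S : {set arc n}) (w : weight n) : bool :=
  [forall c in S, w c.1 != w c.2].

(* (B, w, T) stands for the circle diagram obtained by gluing the reflection of
   T on top of B, oriented by w. *)
Definition is_circle_diagram n (d : {set arc n} * weight n * {set arc n})
    : bool :=
  let: (B, w, T) := d in
  [&& is_weight w, is_cup_diagram B, is_cup_diagram T, oriented B w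
    & oriented T w].

Definition circle_diagram (n : nat) :=
  {d : {set arc n} * weight n * {set arc n} | is_circle_diagram d}.

(* Two lines of vertices.  Below the lower line are the cups of cup_part; above
   the upper line are the caps of (the reflection of) cap_part; between them,
   each arc of mid_part gives a cap on the lower line and its mirror image cup
   on the upper line, and the vertices of the two lines which are not ends of an
   arc of mid_part are joined by vertical strands. *)
Record stack (n : nat) := Stack {
  cup_part : {set arc n};
  mid_part : {set arc n};
  cap_part : {set arc n} }.

(* (false, i) is the vertex i of the lower line, (true, i) of the upper line *)
Definition point (n : nat) := (bool * vertex n)%type.

Definition joined_by_arc n (D : stack n) (p q : point n) : bool :=
  (p.1 == q.1) &&
  [exists c in mid_part D :|: (if p.1 then cap_part D else cup_part D),
     (c == (p.2, q.2)) || (c == (q.2, p.2))].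

Definition joined_by_strand n (D : stack n) (p q : point n) : bool :=
  [&& p.1 != q.1, p.2 == q.2
    & [forall c in mid_part D, (p.2 != c.1) && (p.2 != c.2)]].

Definition same_circle n (D : stack n) : rel (point n) :=
  connect [rel p q | joined_by_arc D p q || joined_by_strand D p q].

(* o p is true when the strand at p is oriented downwards *)
Definition orientation (n : nat) := {ffun point n -> bool}.

Definition is_orientation n (D : stack n) (o : orientation n) : bool :=
  [forall p, forall q, (joined_by_arc D p q ==> (o p != o q)) &&
                       (joined_by_strand D p q ==> (o p == o q))].

(* The arcs of X attached to the given line which lie on the circle of p,
   counted 1 if the strand at their left end is oriented downwards, and -1
   otherwise. *)
Definition signed_count n (D : stack n) (o : orientation n) (p : point n)
    (line : bool) (X : {set arc n}) : int :=
  \sum_(c in X | same_circle D p (line, c.1))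
     (if o (line, c.1) then 1 else -1).

(* The tangent of the circle of p turns by turning_number D o p half-turns
   anticlockwise in the unrolled picture.  A cup oriented downwards at its left
   end (down, right, up) and a cap oriented downwards at its left end
   (up, left, down) are both half-turns anticlockwise. A closed simple curve
   in the plane is anticlockwise if this is 2 and clockwise if it is -2. *)
Definition turning_number n (D : stack n) (o : orientation n) (p : point n)
    : int :=
  signed_count D o p false (cup_part D) + signed_count D o p false (mid_part D)
  + signed_count D o p true (mid_part D) + signed_count D o p true (cap_part D).

(* The class of the circle of p in pi_1 of the cylinder, i.e. the number of
   times it crosses the dashed line rightwards minus leftwards.  Only wrapping
   arcs cross it: a cup oriented downwards at its left end does so rightwards,
   a cap oriented downwards at its left end leftwards. *)
Definition winding_number n (D : stack n) (o : orientation n) (p : point n)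
    : int :=
  let wrap (X : {set arc n}) := [set c in X | wrapping c] in
  signed_count D o p false (wrap (cup_part D))
  - signed_count D o p false (wrap (mid_part D))
  + signed_count D o p true (wrap (mid_part D))
  - signed_count D o p true (wrap (cap_part D)).

Variant kind := Anticlockwise | Clockwise | Leftwards | Rightwards.

Definition nat_of_kind (k : kind) : nat :=
  match k with
  | Anticlockwise => 0 | Clockwise => 1 | Leftwards => 2 | Rightwards => 3
  end%N.

Definition kind_of_nat (i : nat) : kind :=
  match i with
  | 0 => Anticlockwise | 1 => Clockwise | 2 => Leftwards | _ => Rightwards
  end%N.

Lemma nat_of_kindK : cancel nat_of_kind kind_of_nat.
Proof. by case. Qed.

HB.instance Definition _ := Equality.copy kind (can_type nat_of_kindK).

Definition circle_kind n (D : stack n) (o : orientation n) (p : point n)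
    : kind :=
  let w := winding_number D o p in
  if w == 0 then
    if 0 < turning_number D o p then Anticlockwise else Clockwise
  else if 0 < w then Rightwards else Leftwards.

(* None means that the result is 0. *)
Definition merge (k1 k2 : kind) : option kind :=
  match k1, k2 with
  | Anticlockwise, k | k, Anticlockwise => Some k
  | Leftwards, Rightwards | Rightwards, Leftwards => Some Clockwise
  | _, _ => None
  end.

(* All terms which occur for some type (usual or essential) of the two resulting
   circles; in a given surgery only those of the correct types are kinds of an
   orientation of the resulting diagram. *)
Definition split (k : kind) : seq (kind * kind) :=
  match k with
  | Anticlockwise => [:: (Clockwise, Anticlockwise); (Anticlockwise, Clockwise);
                         (Leftwards, Rightwards); (Rightwards, Leftwards)]
  | Clockwise => [:: (Clockwise, Clockwise)]
  | _ => [:: (Clockwise, k); (k, Clockwise)]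
  end.

Definition cut n (D : stack n) (c : arc n) : stack n :=
  Stack (cup_part D) (mid_part D :\ c) (cap_part D).

(* D oriented by y occurs, with coefficient 1, in the result of the surgery at
   c on D oriented by x. *)
Definition surgery_term n (D : stack n) (c : arc n) (x y : orientation n)
    : bool :=
  let D' := cut D c in
  let p : point n := (false, c.1) in
  let q : point n := (true, c.1) in
  [&& is_orientation D' y,
      [forall r, same_circle D p r || same_circle D q r || (y r == x r)] &
      if same_circle D p q then
        (circle_kind D' y (false, c.1), circle_kind D' y (false, c.2))
          \in split (circle_kind D x p)
      else
        Some (circle_kind D' y p)
          == merge (circle_kind D x p) (circle_kind D x q)].

(* A linear combination is given by its coefficients on all orientations. *)
Definition surgery n (D : stack n) (c : arc n)
    (v : {ffun orientation n -> nat}) : {ffun orientation n -> nat} :=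
  [ffun y => (\sum_(x : orientation n) surgery_term D c x y * v x)%N].

(* c is not nested in another arc of R, i.e. when R is the set of the arcs in
   the middle the cap and the cup given by c can be connected. *)
Definition outermost n (R : {set arc n}) (c : arc n) : bool :=
  (c \in R) && [forall d in R, (interval c \subset interval d) ==> (d == c)].

Fixpoint surgeries n (k : nat) (D : stack n) (v : {ffun orientation n -> nat})
    : {ffun orientation n -> nat} :=
  if k is k'.+1 then
    if [pick c | outermost (mid_part D) c] is Some c then
      surgeries k' (cut D c) (surgery D c v)
    else v
  else v.

Definition stack_orientation n (w1 w2 : weight n) : orientation n :=
  [ffun p => if p.1 then w2 p.2 else w1 p.2].

(* The coefficient of z in the product x y. *)
Definition arc_coefficient n (x y z : circle_diagram n) : nat :=
  let: (B, w1, T) := val x in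
  let: (U, w2, V) := val y in
  let: (B', w, V') := val z in
  if [&& T == U, B' == B & V' == V] then
    surgeries #|T| (Stack B T V)
      [ffun o => (o == stack_orientation w1 w2 : nat)] (stack_orientation w w)
  else 0%N.

(* A is the annular arc algebra and C its basis of oriented circle diagrams.
   A basis and its structure constants determine A (including its unit) up to
   isomorphism. *)
Definition annular_arc_algebra (K : fieldType) (n : nat) (A : falgType K)
    (C : circle_diagram n -> A) : Prop :=
  basis_of {:A}%VS (codom C) /\
  forall x y : circle_diagram n,
    C x * C y = \sum_(z : circle_diagram n) C z *+ arc_coefficient x y z.

(* Main.v *)
(* For cup diagrams S and T let A_{S,T} be the span of the diagrams C^w_{S,T}.
   The components e_S of 1 in the A_{S,S} are orthogonal idempotents with sum 1,
   and A_{S,T} = e_S A e_T has dimension N(S,T), the number of weights orienting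
   both S and T.  When S and T match the same pairs of vertices, all circles met
   while multiplying A_{S,T} by A_{T,S} are small and can be listed explicitly.
   This shows that the number of cups which are not oriented downwards at their
   left end is a grading of A_{S,S}, so A_{S,S} is local with residue field K,
   and that A_{S,T} A_{T,S} lies in its radical for S <> T.  When the matchings
   differ, N(S,T) < N(S,S), so A e_S and A e_T are not isomorphic either.  Hence
   the A e_S are the indecomposable projectives and the Cartan matrix is N, a
   Gram matrix.  It has two equal rows, since N(S,T) only depends on the pairs of
   vertices matched by S: make the outer arc of the nested cup diagram either
   staying or wrapping. *)
Require Import Defs.
From mathcomp Require Import all_boot all_order all_algebra all_field.
From Stdlib Require Import ClassicalEpsilon.
From HB Require Import structures.
From mathcomp Require Import zify.
Import Defs.

Set Implicit Arguments.
Unset Strict Implicit.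
Unset Printing Implicit Defensive.

Import Order.TTheory GRing.Theory Num.Theory.
Local Open Scope ring_scope.

(** * Modules and Cartan matrices *)

Lemma isomorphic_sym (A : nzRingType) (M N : lmodType A) :
  isomorphic M N -> isomorphic N M.
Proof.
case=> f [g fK gK].
have glin : linear g.
  by move=> a x y; apply: (can_inj fK); rewrite gK linearP !gK.
pose gL : {linear N -> M} :=
  HB.pack g (@GRing.isLinear.Build A N M _ g glin).
by exists gL, f.
Qed.

Lemma isomorphic_trans (A : nzRingType) (L M N : lmodType A) :
  isomorphic L M -> isomorphic M N -> isomorphic L N.
Proof.
by move=> [f fb] [g gb]; exists (g \o f); exact: bij_comp.
Qed.

Lemma subquotient_iso_trans (A : nzRingType) (M : lmodType A)
    (U' U : {pred M}) (L N : lmodType A) :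
  isomorphic L N -> subquotient_iso U' U L -> subquotient_iso U' U N.
Proof.
move=> [g gb] [f [flin fsurj fker]]; exists (g \o f); split=> [a u v u1 v1|y|u u1].
- by rewrite /= flin // linearP.
- have [h gK hK] := gb; have [u u1 fu] := fsurj (h y).
  by exists u => //=; rewrite fu.
- split=> [gfu|/(fker u u1) /= ->]; last by rewrite linear0.
  by apply/(fker u u1)/(bij_inj gb); rewrite linear0.
Qed.

Lemma simple_cyclic (A : nzRingType) (L : lmodType A) (x y : L) :
  simple_module L -> x != 0 -> exists a, y = a *: x.
Proof.
move=> [_ Lsimple] x0.
pose U : {pred L} :=
  fun z => if excluded_middle_informative (exists a, z = a *: x) then true
           else false.
have UP z : z \in U <-> exists a, z = a *: x.
  by rewrite unfold_in /U; case: excluded_middle_informative.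
have Uclosed : submod_closed U.
  split; first by apply/UP; exists 0; rewrite scale0r.
  move=> a u v /UP[b ->] /UP[c ->]; apply/UP.
  by exists (a * b + c); rewrite scalerDl scalerA.
case: (Lsimple U Uclosed) => UE; last by apply/UP; rewrite UE.
have : x \in U by apply/UP; exists 1; rewrite scale1r.
by rewrite UE inE (negPf x0).
Qed.

Section CornerInverse.
Variables (R : nzRingType) (e t : R).
Hypotheses (ee : e * e = e) (ete : e * t * e = t).

(** Geometric series: [W] inverts [1 - t] and commutes with [e]. As [e - t] is [e * (1 - t)], its
    inverse in the corner of [e] is [W * e]. *)
Lemma corner_inverse N : t ^+ N = 0 ->
  exists v, (e - t) * v = e /\ v * (e - t) = e.
Proof.
move=> tN; pose W := \sum_(i < N) t ^+ i.
have et : e * t = t by rewrite -ete !mulrA ee.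
have te : t * e = t by rewrite -ete -!mulrA ee.
have W1 : (1 - t) * W = 1.
  by rewrite -opprB mulNr -subrX1 tN sub0r opprK.
have eW : e * W = W * e.
  have c1 : GRing.comm e t by rewrite /GRing.comm et te.
  rewrite mulr_sumr mulr_suml; apply: eq_bigr => i _.
  exact: commrX.
have tW : t * W = W * t.
  rewrite mulr_sumr mulr_suml; apply: eq_bigr => i _.
  by rewrite -exprS exprSr.
have W2 : W * (1 - t) = 1 by rewrite mulrBr mulr1 -tW -[W in W - _]mul1r -mulrBl.
have e1 : e - t = e * (1 - t) by rewrite mulrBr mulr1 et.
have e2 : e - t = (1 - t) * e by rewrite mulrBl mul1r te.
exists (W * e); split.
- by rewrite e1 -mulrA [(1 - t) * _]mulrA W1 mul1r ee.
- by rewrite -mulrA e1 [e * (e * _)]mulrA ee -e1 e2 mulrA W2 mul1r.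
Qed.

End CornerInverse.

(** * One-dimensional modules given by characters *)

Section CharacterModule.
Variables (K : fieldType) (A : falgType K) (eps : {rmorphism A -> K}).
Hypothesis epsZ : forall k : K, eps k%:A = k.

Let char_scale (a : A) (x : K) : K := eps a * x.

Lemma char_scaleA a b x : char_scale a (char_scale b x) = char_scale (a * b) x.
Proof. by rewrite /char_scale rmorphM mulrA. Qed.

Lemma char_scale1 : left_id 1 char_scale.
Proof. by move=> x; rewrite /char_scale rmorph1 mul1r. Qed.

Lemma char_scaleDr : right_distributive char_scale +%R.
Proof. by move=> a x y; rewrite /char_scale mulrDr. Qed.

Lemma char_scaleDl x : {morph char_scale^~ x : a b / a + b}.
Proof. by move=> a b; rewrite /char_scale rmorphD mulrDl. Qed.

Definition char_module : lmodType A :=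
  HB.pack K (GRing.Zmodule_isLmodule.Build A K
    char_scaleA char_scale1 char_scaleDr char_scaleDl).

Lemma char_moduleZ (a : A) (x : char_module) : a *: x = eps a * (x : K) :> K.
Proof. by []. Qed.

Lemma char_module_simple : simple_module char_module.
Proof.
split; first by exists (1 : K); exact: oner_neq0.
move=> U [U0 Ulin].
case: (classic (exists2 u : char_module, u \in U & u != 0)) => [[u uU u0]|nU].
  right=> y; rewrite [RHS]inE.
  have -> : y = (((y : K) / (u : K))%:A : A) *: u + 0.
    by rewrite addr0; rewrite char_moduleZ epsZ divfK.
  exact: Ulin.
left=> y; rewrite inE; apply/idP/eqP => [yU|-> //].
by apply/eqP/negPn/negP => y0; apply: nU; exists y.
Qed.

(** Since [A] is the sum of the scalars and the kernel of [eps], the generator [v] spans [L] over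
    [K]; the isomorphism is the coordinate along [v]. *)
Lemma iso_char_module (L : lmodType A) (v : L) :
  v != 0 -> (forall y, exists a, y = a *: v) ->
  (forall a, eps a = 0 -> a *: v = 0) -> isomorphic L char_module.
Proof.
move=> v0 vgen vker.
have vE a : a *: v = (eps a)%:A *: v.
  apply/eqP; rewrite -subr_eq0 -scalerBl; apply/eqP/vker.
  by rewrite rmorphB /= epsZ subrr.
have coef y : exists k : K, k%:A *: v == y.
  by have [a ->] := vgen y; exists (eps a); rewrite -vE.
pose f y : char_module := xchoose (coef y).
have fE y : (f y : K)%:A *: v = y by apply/eqP/(xchooseP (coef y)).
have kinj : injective (fun k : K => k%:A *: v).
  move=> k l /eqP; rewrite -subr_eq0 -scalerBl -scalerBl => /eqP kl.
  apply/eqP; rewrite -subr_eq0; apply/negPn/negP => kl0.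
  case/negP: v0; rewrite -[v](scale1r) -[1 : A]scale1r -(mulVf kl0).
  by rewrite -scalerA -mulr_algl -scalerA kl scaler0.
have flin : linear f.
  move=> a x y; apply: kinj; rewrite fE.
  rewrite -[in LHS](fE x) -[in LHS](fE y) scalerA vE rmorphM /= epsZ -scalerDl.
  by rewrite -scalerDl.
pose fL : {linear L -> char_module} :=
  HB.pack f (@GRing.isLinear.Build A L char_module _ f flin).
exists fL; exists (fun k : K => k%:A *: v) => [y|k]; first exact: fE.
by apply: kinj; exact: fE.
Qed.

End CharacterModule.

(** * Cartan matrix of an algebra with orthogonal local idempotents *)

Section CartanMatrix.
Variables (K : fieldType) (A : falgType K) (I : finType).
Variables (e : I -> A) (eps : I -> {rmorphism A -> K}).
Hypothesis e_orth : forall i j, e i * e j = if i == j then e i else 0.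
Hypothesis e_sum : \sum_i e i = 1.
Hypothesis epsZ : forall i (k : K), eps i k%:A = k.
Hypothesis eps1 : forall i, eps i (e i) = 1.
(** This makes each corner [e_i A e_i] a local ring with residue field [K]. *)
Hypothesis eps_nil : forall i a,
  e i * a * e i = a -> eps i a = 0 -> exists N, a ^+ N = 0.

Let ee i : e i * e i = e i. Proof. by rewrite e_orth eqxx. Qed.

Lemma eps_e i j : eps i (e j) = (i == j)%:R.
Proof.
case: eqVneq => [<-|ij]; first exact: eps1.
by rewrite -[LHS]mul1r -(eps1 i) -rmorphM /= e_orth (negPf ij) rmorph0.
Qed.

Let E i : lmodType A := char_module (eps i).

(** As the [e i] sum to 1, one of them does not kill [L] and fixes some [v]. If an [a] in the kernel
    of [eps i] did not kill [v], some [b * a] would fix [v], and so would its corner part [c], which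
    is nilpotent. *)
Lemma simple_iso (L : lmodType A) :
  simple_module L -> exists i, isomorphic L (E i).
Proof.
move=> Ls; have [[v0 v0N0] _] := Ls.
have [i vi] : exists i, e i *: v0 != 0.
  apply/existsP; apply: contraR v0N0 => /existsPn H.
  rewrite -[v0]scale1r -e_sum scaler_suml big1 // => i _.
  by apply/eqP/negPn.
set v := e i *: v0 in vi; have ev : e i *: v = v by rewrite scalerA ee.
exists i; apply: (iso_char_module (epsZ i) vi) => [y|a a0].
  exact: simple_cyclic.
apply/eqP/negPn/negP => av; have [b vE] := simple_cyclic v Ls av.
pose c := e i * (b * a) * e i.
have ecc : e i * c * e i = c by rewrite /c !mulrA ee -!mulrA ee.
have [|N cN] := eps_nil ecc; first by rewrite !rmorphM /= a0 !(mulr0, mul0r).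
have cv : c *: v = v by rewrite -!scalerA ev -vE ev.
have : c ^+ N *: v = v by elim: (N) => [|k IH]; rewrite ?scale1r // exprS -scalerA IH.
by rewrite cN scale0r => v0'; rewrite -v0' eqxx in vi.
Qed.

Lemma iso_char_inj i j : isomorphic (E i) (E j) -> i = j.
Proof.
case=> f /bij_inj finj; pose one : E i := (1 : K).
have f1 : f one != 0.
  apply/eqP => f0; have /eqP := oner_neq0 K; apply.
  by apply: (finj one 0); rewrite f0 linear0.
have : f (e i *: one) = e i *: f one by rewrite linearZ.
have -> : e i *: one = one by rewrite -[LHS]/(eps i (e i) * 1) eps1 mulr1.
rewrite [RHS]char_moduleZ eps_e => H.
apply/eqP; rewrite eq_sym; apply/negPn/negP => ij; case/negP: f1.
by apply/eqP; rewrite H (negPf ij) mul0r.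
Qed.

(* A e_i is a direct summand of P: lift P -> E i to P -> A e_i and A e_i -> E i to
   A e_i -> P; the composite on A e_i is the right multiplication by a unit of
   the local ring e_i A e_i. *)
Lemma projective_cover_embedding i (P : lmodType A) (f : {linear P -> E i}) :
  indecomposable P -> projective P -> (forall y, exists x, f x = y) ->
  exists h : {linear P -> A^o}, injective h /\
    forall a : A, (exists x, h x = a) <-> a * e i = a.
Proof.
move=> [_ Pind] Pproj fsurj.
have glin : linear (fun a : A^o => eps i a : E i).
  by move=> a u v; rewrite char_moduleZ rmorphD /= rmorphM.
pose g : {linear A^o -> E i} :=
  HB.pack (fun a : A^o => eps i a : E i) (@GRing.isLinear.Build A A^o (E i) _ _ glin).
have gsurj y : exists x, g x = y.
  by exists ((y : K)%:A : A); exact: epsZ.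
have [h0 h0E] := Pproj _ _ g f gsurj.
(* Right multiplication by [e i] moves the lift into [A e_i] without changing its image under
   [eps i]. *)
have hlin : linear (fun x => (h0 x : A) * e i : A^o).
  by move=> a u v; rewrite linearP mulrDl; congr (_ + _); exact/esym/mulrA.
pose h : {linear P -> A^o} :=
  HB.pack (fun x => (h0 x : A) * e i : A^o) (@GRing.isLinear.Build A P A^o _ _ hlin).
have hZ a x : h (a *: x) = a * h x :> A by rewrite linearZ.
have he x : (h x : A) * e i = h x by rewrite /= -mulrA ee.
have eps_h x : eps i (h x) = f x.
  by rewrite /= rmorphM eps1 mulr1 -h0E.
have [p0 fp0] := fsurj (1 : K).
(* The lift from [A e_i] to [P] sends [a] to [a *: p]. Followed by [h] it is right multiplication by
   [u], which [eps i] sends to 1, so that [e i - u] is nilpotent. *)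
pose p := e i *: p0; pose u : A := h p.
have fp : f p = 1 :> K by rewrite linearZ fp0 [LHS]char_moduleZ eps1 mul1r.
have eu : e i * u = u by rewrite /u -hZ scalerA ee.
have ue : u * e i = u by exact: he.
have ete : e i * (e i - u) * e i = e i - u by rewrite mulrBr mulrBl ee eu ee ue.
have [|N tN] := eps_nil ete; first by rewrite rmorphB /= eps1 /u eps_h fp subrr.
have [u' [uu' u'u]] := corner_inverse (ee i) ete tN.
rewrite opprB addrC subrK in uu' u'u.
(* An idempotent endomorphism, which splits [P] into its image [U] and the kernel [V] of [h]. *)
pose theta x := ((h x : A) * u') *: p.
have htheta x : h (theta x) = h x by rewrite hZ -mulrA u'u he.
have thetalin a x y : theta (a *: x + y) = a *: theta x + theta y.
  by rewrite /theta linearP mulrDl scalerDl; congr (_ + _); rewrite [RHS]scalerA mulrA.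
pose U : {pred P} := [pred x | theta x == x].
pose V : {pred P} := [pred x | h x == 0].
have Uc : submod_closed U.
  split=> [|a x y]; rewrite !inE; first by rewrite /theta linear0 mul0r scale0r.
  by rewrite thetalin => /eqP-> /eqP->.
have Vc : submod_closed V.
  split=> [|a x y]; rewrite !inE; first by rewrite linear0.
  by rewrite linearP => /eqP-> /eqP->; rewrite scaler0 addr0.
have UV x : x \in U -> x \in V -> x = 0.
  by rewrite !inE => /eqP <- /eqP; rewrite htheta /theta => ->; rewrite mul0r scale0r.
have UVsum x : exists u v, [/\ u \in U, v \in V & x = u + v].
  exists (theta x), (x - theta x); split; last by rewrite addrC subrK.
    by rewrite inE {1}/theta htheta.
  by rewrite inE linearB htheta subrr.
exists h; split.
  (* [U] contains [p], which [f] sends to 1, so it is [V] that vanishes. *)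
  case: (Pind U V Uc Vc UV UVsum) => W0; last first.
    move=> x y hxy; apply/eqP; rewrite -subr_eq0.
    have := W0 (x - y); rewrite !inE linearB hxy subrr eqxx => <- //.
  have : p \in U.
    by rewrite inE /theta uu' scalerA ee.
  rewrite W0 inE => /eqP p00; have := oner_neq0 K.
  by rewrite -fp p00 linear0 eqxx.
move=> a; split=> [[x <-]|ae]; first exact: he.
by exists ((a * u') *: p); rewrite hZ -mulrA u'u.
Qed.

(* Along a composition series, the dimension of the part fixed by e_j grows by one
   at the factors isomorphic to E j and is constant at the others. *)
Lemma jh_multiplicity_dim i j (P L : lmodType A) (h : {linear P -> A^o}) c
    (V : {vspace A}) :
  injective h -> (forall a : A, (exists x, h x = a) <-> a * e i = a) ->
  isomorphic L (E j) -> jh_multiplicity P L c ->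
  (forall a, a \in V = (e j * a * e i == a)) -> c = \dim V.
Proof.
move=> hinj him Liso [l [U [I0 [[U0 Ul Uc Us] I0P cE]]]] VP.
have hZ a x : h (a *: x) = a * h x :> A by rewrite linearZ.
(* [W] is the image under [h] of [e_j U_k]; its dimension counts the factors isomorphic to [L] met
   so far. *)
have step k : (k <= l)%N -> exists W : {vspace A},
   (forall a, a \in W <-> exists2 x, x \in U k & h (e j *: x) = a) /\
   \dim W = #|[set k' in I0 | (k' < k)%N]|.
  elim: k => [_|k IHk ltkl].
    exists 0%VS; split; last first.
      rewrite dimv0; apply/esym/eqP; rewrite cards_eq0; apply/eqP/setP => k'.
      by rewrite !inE andbF.
    move=> a; rewrite memv0; split=> [/eqP->|[x]].
      by exists 0; rewrite ?U0 ?inE // scaler0 linear0.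
    by rewrite U0 inE => /eqP-> <-; rewrite scaler0 linear0.
  have [W [WP dimW]] := IHk (ltnW ltkl).
  have [Usub [S Ssimple Ssub]] := Us k ltkl.
  have [Ukc0 Ukc] := Uc k (ltnW ltkl).
  have [Uk1c0 Uk1c] := Uc k.+1 ltkl.
  have ZU a x : x \in U k.+1 -> a *: x \in U k.+1.
    by move=> xU; rewrite -[_ *: _]addr0 Uk1c.
  pose k0 := Ordinal ltkl.
  have cardE : #|[set k' in I0 | (k' < k.+1)%N]|
      = ((k0 \in I0) + #|[set k' in I0 | (k' < k)%N]|)%N.
    rewrite (cardsD1 k0) !inE ltnSn andbT; congr (_ + _)%N.
    apply: eq_card => k'; rewrite !inE ltnS [(k' <= k)%N]leq_eqVlt.
    rewrite -[k' == k0]/(val k' == val k0) /= andbCA.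
    by case: ltngtP; rewrite ?andbF ?andbT.
  case: (boolP (k0 \in I0)) => [k0I|k0I].
    have [f [flin fsurj fker]] := subquotient_iso_trans Liso ((I0P k0).1 k0I).
    have [u uU fu] := fsurj (1 : K).
    have fZ a x : x \in U k.+1 -> f (a *: x) = eps j a * (f x : K) :> K.
      move=> xU; rewrite -[a *: x]addr0 flin // (_ : f 0 = 0) ?addr0 //.
      exact/(fker _ Uk1c0).
    pose w : A := h (e j *: u).
    have feu : f (e j *: u) = 1 :> K by rewrite fZ // fu eps1 mul1r.
    (* The vector [e j *: u] is sent to 1 in the factor [E j], so it spans [e_j U_{k+1}] modulo
       [U_k]. *)
    exists (W + <[w]>)%VS; split=> [a|].
      split=> [/memv_addP[a1 /WP[x xU <-] [_ /vlineP[q ->] ->]]|[x xU <-]].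
        exists (q%:A *: u + x); first by rewrite Uk1c // Usub.
        rewrite scalerDr linearD addrC; congr (_ + _).
        by rewrite scalerA -[e j * _]/(e j * q%:A) mulr_algr -mulr_algl -scalerA hZ mulr_algl.
      rewrite -[e j *: x](subrK ((f x : K)%:A *: (e j *: u))) linearD.
      apply: memv_add; last first.
        by rewrite hZ mulr_algl memvZ ?memv_line.
      apply/WP; exists (e j *: x - (f x : K)%:A *: (e j *: u)).
        have Y : e j *: x - (f x : K)%:A *: (e j *: u)
            = (- (f x : K)%:A : A) *: (e j *: u) + e j *: x.
          by rewrite addrC scaleNr.
        rewrite Y; apply/(fker _ (Uk1c _ _ _ (ZU _ _ uU) (ZU _ _ xU))).
        rewrite flin ?ZU // char_moduleZ feu rmorphN /= epsZ mulr1.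
        by rewrite fZ // eps1 mul1r addNr.
      rewrite scalerBr scalerA ee; congr (h (_ - _)).
      rewrite !scalerA; congr (_ *: _).
      by rewrite -mulrA mulr_algl -scalerAr ee.
    rewrite dimv_disjoint_sum ?dim_vline.
      rewrite cardE k0I dimW addnC; congr (_ + _)%N.
      rewrite /w -[0 in X in nat_of_bool (~~ X)](linear0 h) (inj_eq hinj).
      suff -> : e j *: u != 0 by [].
      apply/eqP => eu0; have := oner_neq0 K; rewrite -feu eu0.
      by rewrite ((fker 0 Uk1c0).2) ?eqxx.
    apply/eqP; rewrite -subv0; apply/subvP => a; rewrite memv_cap => /andP[/WP[x xU <-]].
    case/vlineP=> q; rewrite -mulr_algl -hZ => /hinj qE.
    rewrite qE; have : f (e j *: x) = 0 :> K.
      apply/(fker _); first exact/ZU/Usub.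
      by rewrite -[e j *: x]addr0 Ukc.
    rewrite qE fZ ?ZU // feu epsZ mulr1 => ->.
    by rewrite scale0r scale0r linear0 mem0v.
  (* The factor is now some [E j'] with [j' != j], which [e j] kills, so [e_j U_{k+1}] lies in
     [U_k]. *)
  have [j' Sj'] := simple_iso Ssimple.
  have j'j : j' != j.
    apply: contraNneq k0I => jj'; apply/(I0P k0).
    apply: (subquotient_iso_trans _ Ssub); apply: isomorphic_trans Sj' _.
    by rewrite jj'; exact: isomorphic_sym.
  have [f [flin fsurj fker]] := subquotient_iso_trans Sj' Ssub.
  exists W; split=> [a|]; last by rewrite cardE (negPf k0I).
  split=> [/WP[x xU <-]|[x xU <-]]; first by exists x; rewrite ?Usub.
  apply/WP; exists (e j *: x); last by rewrite scalerA ee.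
  apply/(fker _ (ZU _ _ xU)); rewrite -[e j *: x]addr0 flin // char_moduleZ.
  rewrite eps_e (negPf j'j) mul0r add0r.
  exact/(fker _ Uk1c0).
have [W [WP dimW]] := step l (leqnn l).
rewrite -cE; have -> : V = W.
  apply/vspaceP => a; apply/idP/idP; rewrite VP.
    move/eqP=> ea; apply/WP; have [x hx] : exists x, h x = a.
      by apply/him; rewrite -ea -!mulrA ee.
    by exists x; rewrite ?Ul // hZ hx -{1}ea !mulrA ee.
  case/WP => x _ <-; rewrite hZ mulrA ee -mulrA.
  by apply/eqP; congr (_ * _); apply/(him _).1; exists x.
by rewrite dimW; apply: eq_card => k; rewrite inE ltn_ord andbT.
Qed.

(** Up to isomorphism [L j] is [E (phi j)] and [P i] is [A e_{phi i}], so the multiplicity is the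
    dimension of [e_{phi j} A e_{phi i}]. Every [E s] is simple, hence occurs in the enumeration. *)
Lemma cartan_matrix_dim m (M : 'M[int]_m) (V : I -> I -> {vspace A}) :
  (forall i j a, a \in V i j = (e i * a * e j == a)) -> is_cartan_matrix A M ->
  exists phi : 'I_m -> I, (forall i j, M i j = (\dim (V (phi j) (phi i)))%:Z) /\
    forall s, exists i, phi i = s.
Proof.
move=> VP [L [P [Lsimple _ Lall PP Mjh]]].
have [phi Lphi] := fin_all_exists (fun i => simple_iso (Lsimple i)).
exists phi; split=> [i j|s].
  have [c cjh ->] := Mjh i j; have [Pind Pproj [f fsurj _]] := PP i.
  have [g gb] := Lphi i; have [g' gK g'K] := gb.
  have [|h [hinj him]] :=
    @projective_cover_embedding (phi i) (P i) (g \o f) Pind Pproj.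
    by move=> y; have [x fx] := fsurj (g' y); exists x; rewrite /= fx g'K.
  by congr Posz; apply: (jh_multiplicity_dim hinj him (Lphi j) cjh).
have [i Li] := Lall _ (char_module_simple (epsZ s)).
exists i; apply/esym/iso_char_inj.
exact: isomorphic_trans Li (Lphi i).
Qed.

End CartanMatrix.

(** * Surgery on small circles *)

Definition is_end n (c : arc n) (i : vertex n) : bool := (i == c.1) || (i == c.2).

Definition reverse n (c : arc n) : arc n := (c.2, c.1).

Lemma is_end1 n (c : arc n) : is_end c c.1.
Proof. by rewrite /is_end eqxx. Qed.

Lemma is_end2 n (c : arc n) : is_end c c.2.
Proof. by rewrite /is_end eqxx orbT. Qed.

Lemma is_end_reverse n (c : arc n) : is_end (reverse c) =1 is_end c.
Proof. by move=> i; rewrite /is_end orbC. Qed.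

Section CupDiagram.
Variables (n : nat) (S : {set arc n}).
Hypothesis cupS : is_cup_diagram S.

Lemma cup_ends_neq c : c \in S -> c.1 != c.2.
Proof. by move=> cS; have /and3P[/forall_inP/(_ _ cS)] := cupS. Qed.

Lemma cup_cover i : exists2 c, c \in S & is_end c i.
Proof.
have /and3P[_ /forallP/(_ i) H _] := cupS.
have /card_gt0P[c] : (0 < #|[set c in S | (i == c.1) || (i == c.2)]|)%N.
  by rewrite (eqP H).
by rewrite inE => /andP[cS ci]; exists c.
Qed.

Lemma cup_uniq i c d :
  c \in S -> d \in S -> is_end c i -> is_end d i -> c = d.
Proof.
move=> cS dS ci di; have /and3P[_ /forallP/(_ i)/cards1P[a aE] _] := cupS.
have : c \in [set c in S | (i == c.1) || (i == c.2)] by rewrite inE cS.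
have : d \in [set c in S | (i == c.1) || (i == c.2)] by rewrite inE dS.
by rewrite aE !inE => /eqP-> /eqP->.
Qed.

Lemma cup_end_eq c d : c \in S -> d \in S -> is_end c d.1 = (d == c).
Proof.
move=> cS dS; apply/idP/eqP => [cd|->]; last exact: is_end1.
exact: (cup_uniq dS cS (is_end1 d)).
Qed.

Lemma cup_reverse c : c \in S -> reverse c \notin S.
Proof.
move=> cS; apply/negP => rS; have := cup_ends_neq cS.
have /(congr1 fst)/= -> : c = reverse c.
  by apply: (cup_uniq cS rS (is_end1 c)); rewrite is_end_reverse is_end1.
by rewrite eqxx.
Qed.

End CupDiagram.

(** The interval is a nonempty proper run of consecutive segments of the circle, whose beginning and
    end give the ends of the arc in order. *)
Lemma interval_inj n (c d : arc n) : c.1 != c.2 -> d.1 != d.2 ->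
  interval c = interval d -> c = d.
Proof.
case: c d => [a b] [a' b'] /= ab a'b' /setP E.
have Ei (i : vertex n) := E i.
have n0 : (0 < 2 * n)%N by apply: leq_ltn_trans (ltn_ord a).
have lt : ((2 * n).-1 < 2 * n)%N by rewrite prednK.
have := Ei a; have := Ei b; have := Ei a'; have := Ei b'.
(* The segment from the last vertex to the first belongs to the interval exactly for wrapping
   arcs. *)
have := Ei (Ordinal lt).
rewrite /interval /wrapping !inE /=.
move: ab a'b'; rewrite -!(inj_eq val_inj) /=.
move=> ab a'b' H1 H2 H3 H4 H5.
have [E1 E2] : a = a' :> nat /\ b = b' :> nat.
  move: (ltn_ord a) (ltn_ord b) (ltn_ord a') (ltn_ord b') H1 H2 H3 H4 H5 ab a'b'.
  move: (nat_of_ord a) (nat_of_ord b) (nat_of_ord a') (nat_of_ord b').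
  clear=> x y x' y'; case: (ltnP y x); case: (ltnP y' x'); lia.
by congr (_, _); apply: val_inj.
Qed.

(** A largest interval is maximal, and it determines its arc. Hence the surgeries cannot stop before
    the middle is empty. *)
Lemma outermost_exists n (T R : {set arc n}) :
  is_cup_diagram T -> R \subset T -> R != set0 -> exists c, outermost R c.
Proof.
move=> cupT RT /set0Pn[c0 c0R].
have [c cR cmax] := arg_maxnP (fun c => #|interval c|) c0R.
exists c; rewrite /outermost; apply/andP; split=> //.
apply/forall_inP => d dR; apply/implyP => cd.
rewrite eq_sym; apply/eqP/interval_inj; try exact/(cup_ends_neq cupT)/(subsetP RT).
by apply/eqP; rewrite eqEcard cd; exact: cmax.
Qed.

Definition sgn (b : bool) : int := if b then 1 else -1.

(** A small circle meets each cup diagram [Y] in a single arc [u]. The subset [X] allows counting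
    only wrapping arcs, or only arcs still in the middle. *)
Lemma signed_count_unique n (D : stack n) o p l (X Y : {set arc n}) u :
  X \subset Y -> (forall c, c \in Y -> same_circle D p (l, c.1) = (c == u)) ->
  signed_count D o p l X = if u \in X then sgn (o (l, u.1)) else 0.
Proof.
move=> XY H; rewrite /signed_count; case: ifP => uX.
  rewrite (big_pred1 u) // => c; case: (boolP (c \in X)) => /= cX.
    by rewrite H ?(subsetP XY).
  by apply/esym/eqP => cu; rewrite cu uX in cX.
rewrite big_pred0 // => c; case: (boolP (c \in X)) => //= cX.
rewrite H ?(subsetP XY) //; apply/eqP => cu.
by rewrite -cu cX in uX.
Qed.

Lemma signed_count_disjoint n (D : stack n) o p l (X : {set arc n}) :
  (forall i, ~~ same_circle D p (l, i)) -> signed_count D o p l X = 0.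
Proof. by move=> H; rewrite /signed_count big_pred0 // => c; rewrite (negPf (H _)) andbF. Qed.

Section SmallCircles.
Variables (n : nat) (S T : {set arc n}).
Hypotheses (cupS : is_cup_diagram S) (cupT : is_cup_diagram T).
Hypothesis ST : forall t, t \in T -> (t \in S) || (reverse t \in S).

Definition mate t := if t \in S then t else reverse t.

Lemma mate_in t : t \in T -> mate t \in S.
Proof. by rewrite /mate => /ST; case: ifP. Qed.

Lemma is_end_mate t : is_end (mate t) =1 is_end t.
Proof. by rewrite /mate; case: ifP => // _; exact: is_end_reverse. Qed.

Lemma mate_of s : s \in S -> exists2 t, t \in T & mate t = s.
Proof.
move=> sS; have [t tT ts] := cup_cover cupT s.1; exists t => //.
by apply: (cup_uniq cupS (mate_in tT) sS _ (is_end1 s)); rewrite is_end_mate.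
Qed.

Lemma is_end_mate1 t : is_end t (mate t).1.
Proof. by rewrite -is_end_mate is_end1. Qed.

Section Circles.
Variable R : {set arc n}.
Hypothesis RT : R \subset T.
Let D := Stack S R S.
Let adj : rel (point n) := [rel p q | joined_by_arc D p q || joined_by_strand D p q].

Lemma adj_sym : symmetric adj.
Proof.
suff H p q : adj p q -> adj q p by move=> p q; apply/idP/idP; exact: H.
move=> /orP[/andP[/eqP pq /existsP[c /andP[cD cpq]]]|/and3P[pq /eqP pq2 H]].
  apply/orP; left; rewrite /joined_by_arc pq eqxx /=.
  by apply/existsP; exists c; rewrite -pq cD orbC.
by apply/orP; right; rewrite /joined_by_strand eq_sym pq pq2 eqxx -pq2.
Qed.

(** The ends of [t] on the lines chosen by [a] are closed under adjacency: the arcs there are [t]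
    and [mate t], and strands link the two lines only once [t] is cut, in which case [a] must choose
    both lines. *)
Lemma same_circle_sub t (a : pred bool) :
  t \in T -> (t \notin R -> forall b, a b) ->
  forall p q, same_circle D p q ->
    (a p.1 && is_end t p.2) = (a q.1 && is_end t q.2).
Proof.
move=> tT at_ p q; apply: (@closed_connect _ adj [pred p | a p.1 && is_end t p.2]).
suff H x y : adj x y -> (a x.1 && is_end t x.2) -> (a y.1 && is_end t y.2).
  move=> x y xy; rewrite !inE; apply/idP/idP; apply: H => //.
  by rewrite adj_sym.
case: x y => b i [b' j] /= xy /andP[ab ti]; move: xy.
case/orP=> [/andP[/= /eqP <- /existsP[d /andP[dD dij]]]|/and3P[/= bb' /eqP <- /forall_inP H]].
  rewrite ab /=.
  have {}dD : (d \in R) || (d \in S) by move: dD; rewrite inE; case: (b).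
  have [di dj] : is_end d i /\ is_end d j.
    by case/orP: dij => /eqP->; rewrite /is_end /= !eqxx ?orbT.
  case/orP: dD => [dR|dS].
    by rewrite (cup_uniq cupT tT (subsetP RT _ dR) ti di).
  by rewrite -is_end_mate (cup_uniq cupS (mate_in tT) dS _ di) // is_end_mate.
rewrite ti andbT; apply: at_; apply/negP => /H.
by rewrite -negb_or -[_ || _]/(is_end t i) ti.
Qed.

Lemma same_circle_ends t b i j : t \in T -> is_end t i -> is_end t j ->
  same_circle D (b, i) (b, j).
Proof.
move=> tT; rewrite -(is_end_mate t i) -(is_end_mate t j) => ti tj.
case: (eqVneq i j) => [->|ij]; first exact: connect0.
apply/connect1/orP; left; rewrite /joined_by_arc eqxx /=.
apply/existsP; exists (mate t); rewrite inE /= (_ : (if b then S else S) = S); last by case: (b).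
rewrite mate_in // orbT /=; move: ti tj ij.
case: (mate t) => x y; rewrite /is_end !xpair_eqE /= => /orP[]/eqP-> /orP[]/eqP->.
all: by rewrite !eqxx ?orbT.
Qed.

Lemma same_circle_uncut t b l i : t \in R ->
  same_circle D (b, t.1) (l, i) = (l == b) && is_end t i.
Proof.
move=> tR; have tT := subsetP RT _ tR; apply/idP/andP => [H|[/eqP-> ti]].
  have uncut : t \notin R -> forall b', pred1 b b' by rewrite tR.
  apply/andP; have := same_circle_sub tT uncut H.
  by rewrite /= eqxx is_end1 => <-.
exact: same_circle_ends (is_end1 t) ti.
Qed.

Lemma same_circle_cut t b l i : t \in T -> t \notin R ->
  same_circle D (b, t.1) (l, i) = is_end t i.
Proof.
move=> tT tR; apply/idP/idP => [H|ti].
  by have := @same_circle_sub t predT tT (fun _ _ => isT) _ _ H; rewrite /= is_end1 => <-.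
case: (eqVneq b l) => [<-|bl]; first exact: same_circle_ends (is_end1 t) ti.
apply: connect_trans (same_circle_ends b tT (is_end1 t) ti) _.
apply/connect1/orP; right; rewrite /joined_by_strand bl eqxx /=.
apply/forall_inP => c cR; rewrite -negb_or; apply: contraNN tR => ci.
by rewrite -(cup_uniq cupT (subsetP RT _ cR) tT ci ti).
Qed.

Let wrap (X : {set arc n}) := [set c in X | wrapping c].

Lemma wrap_sub X : wrap X \subset X.
Proof. by apply/subsetP => c; rewrite inE => /andP[]. Qed.

Lemma same_circle_uncutS t b c : t \in R -> c \in S ->
  same_circle D (b, t.1) (b, c.1) = (c == mate t).
Proof.
move=> tR cS; rewrite same_circle_uncut // eqxx -is_end_mate.
by rewrite (cup_end_eq cupS) // mate_in // (subsetP RT).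
Qed.

Lemma same_circle_uncutR t b c : t \in R -> c \in R ->
  same_circle D (b, t.1) (b, c.1) = (c == t).
Proof.
by move=> tR cR; rewrite same_circle_uncut // eqxx (cup_end_eq cupT) // (subsetP RT).
Qed.

Let one (b : bool) (x : int) : int := if b then x else 0.

Lemma turning_uncut t b o : t \in R ->
  turning_number D o (b, t.1) = sgn (o (b, (mate t).1)) + sgn (o (b, t.1)).
Proof.
move=> tR; have tT := subsetP RT _ tR; rewrite /turning_number /=.
case: b.
  rewrite !(@signed_count_disjoint _ _ _ _ false); last first.
  - by move=> i; rewrite same_circle_uncut.
  - by move=> i; rewrite same_circle_uncut.
  rewrite !add0r addrC (signed_count_unique _ (subxx S) (fun c => @same_circle_uncutS t _ c tR)).
  rewrite mate_in // (signed_count_unique _ (subxx R) (fun c => @same_circle_uncutR t _ c tR)).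
  by rewrite tR.
rewrite !(@signed_count_disjoint _ _ _ _ true); last first.
- by move=> i; rewrite same_circle_uncut.
- by move=> i; rewrite same_circle_uncut.
rewrite !addr0 (signed_count_unique _ (subxx S) (fun c => @same_circle_uncutS t _ c tR)).
rewrite mate_in // (signed_count_unique _ (subxx R) (fun c => @same_circle_uncutR t _ c tR)).
by rewrite tR.
Qed.

Lemma winding_uncut t b o : t \in R ->
  winding_number D o (b, t.1) = sgn b *
    (one (wrapping t) (sgn (o (b, t.1))) - one (wrapping (mate t)) (sgn (o (b, (mate t).1)))).
Proof.
move=> tR; have tT := subsetP RT _ tR; rewrite /winding_number /= -/(wrap S) -/(wrap R).
case: b.
  rewrite !(@signed_count_disjoint _ _ _ _ false); last first.
  - by move=> i; rewrite same_circle_uncut.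
  - by move=> i; rewrite same_circle_uncut.
  rewrite subrr add0r (signed_count_unique _ (wrap_sub S) (fun c => @same_circle_uncutS t _ c tR)).
  rewrite (signed_count_unique _ (wrap_sub R) (fun c => @same_circle_uncutR t _ c tR)).
  by rewrite !inE tR mate_in //= mul1r.
rewrite !(@signed_count_disjoint _ _ _ _ true); last first.
- by move=> i; rewrite same_circle_uncut.
- by move=> i; rewrite same_circle_uncut.
rewrite addr0 subr0 (signed_count_unique _ (wrap_sub S) (fun c => @same_circle_uncutS t _ c tR)).
rewrite (signed_count_unique _ (wrap_sub R) (fun c => @same_circle_uncutR t _ c tR)).
by rewrite !inE tR mate_in //= mulN1r opprB.
Qed.

(** The circle consists of [t] and [mate t]. If these agree, their contributions to the winding
    number cancel and the turning number is 2 or -2. Otherwise exactly one of them wraps, and the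
    winding number is 1 or -1. *)
Lemma kind_uncut t b o : t \in R ->
  if t \in S then circle_kind D o (b, t.1) = (if o (b, t.1) then Anticlockwise else Clockwise)
  else circle_kind D o (b, t.1) \in [:: Leftwards; Rightwards].
Proof.
move=> tR; rewrite /circle_kind turning_uncut // winding_uncut // /mate.
case: (t \in S); first by rewrite subrr mulr0 eqxx; case: (o _).
have : wrapping (reverse t) = ~~ wrapping t.
  have := cup_ends_neq cupT (subsetP RT _ tR).
  by rewrite /wrapping /= -(inj_eq val_inj) /=; case: ltngtP.
move=> ->; rewrite ifF; first by case: ifP.
by case: (wrapping t); case: (b); rewrite /= /sgn; case: (o _).
Qed.

Lemma same_circle_cutS t l c : t \in T -> t \notin R -> c \in S ->
  same_circle D (false, t.1) (l, c.1) = (c == mate t).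
Proof.
move=> tT tR cS; rewrite same_circle_cut // -is_end_mate.
by rewrite (cup_end_eq cupS) // mate_in.
Qed.

Lemma same_circle_cutR t l c : t \in T -> t \notin R -> c \in T ->
  same_circle D (false, t.1) (l, c.1) = (c == t).
Proof. by move=> tT tR cT; rewrite same_circle_cut // (cup_end_eq cupT). Qed.

(** After the cut the circle consists of the cup [mate t], its mirror image and two strands, so it
    is usual whatever the type of [t]. *)
Lemma kind_cut t (o : orientation n) (v := o (false, (mate t).1)) :
  t \in T -> t \notin R -> o (true, (mate t).1) = v ->
  circle_kind D o (false, t.1) = if v then Anticlockwise else Clockwise.
Proof.
move=> tT tR ov; rewrite /circle_kind /turning_number /winding_number /=.
rewrite -/(wrap S) -/(wrap R).
have wR : wrap R \subset T by apply: subset_trans RT; apply: wrap_sub.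
have sR l := signed_count_unique o RT (fun c => @same_circle_cutR t l c tT tR).
have swR l := signed_count_unique o wR (fun c => @same_circle_cutR t l c tT tR).
have sS l := signed_count_unique o (subxx S) (fun c => @same_circle_cutS t l c tT tR).
have swS l := signed_count_unique o (wrap_sub S) (fun c => @same_circle_cutS t l c tT tR).
rewrite !sR !swR !sS !swS !inE (negPf tR) mate_in //= ov -/v.
by rewrite subr0 addr0 subrr eqxx; case: (v).
Qed.

End Circles.

Variables w mu : weight n.

(* Necessary conditions for [v] to tell whether the circle at [s] is anticlockwise
   after merging the circles oriented by [w] and [mu], which are both essential if
   [s] is not in [T]. *)
Definition merged (s : arc n) (v : bool) : bool :=
  (v ==> [&& s \in T, w s.1 & mu s.1]) && ((s \in T) ==> w s.1 || mu s.1).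

Definition partly_merged (R : {set arc n}) (o : orientation n) : Prop :=
  (forall t, t \in R -> o (false, t.1) = w t.1 /\ o (true, t.1) = mu t.1) /\
  (forall t, t \in T -> t \notin R -> merged (mate t) (o (false, (mate t).1))).

Lemma surgery_partly_merged (R : {set arc n}) c x y : R \subset T -> c \in R ->
  partly_merged R x -> surgery_term (Stack S R S) c x y ->
  partly_merged (R :\ c) y.
Proof.
move=> RT cR [xR xT] /and3P[/= yor /forallP yx]; have cT := subsetP RT _ cR.
have yE l t : t \in T -> t != c -> forall i, is_end t i -> y (l, i) = x (l, i).
  move=> tT tc i ti; have := yx (l, i); rewrite !same_circle_uncut //.
  suff -> : is_end c i = false by rewrite !andbF => /eqP.
  by apply: contraNF tc => ci; rewrite (cup_uniq cupT tT cT ti ci).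
(* The two circles at [c] lie on different lines, so only the merge rules occur. *)
rewrite same_circle_uncut //= => H; split=> [t|t tT].
  rewrite !inE => /andP[tc tR]; rewrite !(yE _ t) ?is_end1 ?(subsetP RT) //.
  exact: xR.
rewrite !inE negb_and negbK; case: (eqVneq t c) => [-> _|tc /= tR]; last first.
  by rewrite (yE _ t tT tc) ?is_end_mate1 //; exact: xT.
have R'T : R :\ c \subset T by apply: subset_trans RT; apply: subsetDl.
have cR' : c \notin R :\ c by rewrite !inE eqxx.
set s := mate c; have ys : y (true, s.1) = y (false, s.1).
  have /forallP/(_ (false, s.1))/forallP/(_ (true, s.1))/andP[_ /implyP YS] := yor.
  apply/esym/eqP/YS; rewrite /joined_by_strand eqxx /=.
  apply/forall_inP => d; rewrite !inE => /andP[dc dR]; rewrite -negb_or.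
  apply: contraNN dc => ds; apply/eqP.
  by apply: (cup_uniq cupT (subsetP RT _ dR) cT ds); exact: is_end_mate1.
move: H; rewrite /cut /= kind_cut // -/s.
have [xc1 xc2] := xR _ cR.
have := kind_uncut RT false x cR; have := kind_uncut RT true x cR.
rewrite xc1 xc2 /merged; have cs : (c \in S) = (s \in T).
  rewrite /s /mate; case: ifP => cS; first by rewrite cT.
  by rewrite (negPf (cup_reverse cupT cT)).
rewrite -cs; case: ifP => cS.
  (* Two usual circles: an anticlockwise result needs both to be anticlockwise, and two clockwise
     ones give 0. *)
  move=> -> ->; rewrite /s /mate cS.
  by case: (w _) (mu _) (y _) => [] [] [].
(* Two essential circles merge into a clockwise one or give 0. *)
rewrite !inE => /orP[]/eqP-> /orP[]/eqP-> /=; by case: (y _).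
Qed.

Lemma surgeries_partly_merged k (R : {set arc n})
    (v : {ffun orientation n -> nat}) y : R \subset T ->
  (forall x, v x != 0%N -> partly_merged R x) ->
  surgeries k (Stack S R S) v y != 0%N ->
  exists R' : {set arc n}, [/\ R' \subset T, (#|R'| <= #|R| - k)%N & partly_merged R' y].
Proof.
elim: k R v => [|k IHk] R v RT vR /=.
  by move/vR=> yR; exists R; rewrite subn0.
case: pickP => [c cout|nout].
  have cR : c \in R by case/andP: cout.
  rewrite /cut /= => /IHk[||R' [R'T cardR' yR']].
  - by apply: subset_trans RT; apply: subsetDl.
  - move=> x; rewrite ffunE sum_nat_eq0 => /forallPn[z /=].
    rewrite muln_eq0 negb_or => /andP[zx vz].
    apply: (surgery_partly_merged RT cR (vR _ vz)).
    by case: (surgery_term _ _ _ _) zx.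
  exists R'; split=> //; apply: leq_trans cardR' _.
  by rewrite (cardsD1 c R) cR subSS.
move/vR => yR; exists R; split=> //.
suff -> : R = set0 by rewrite cards0.
apply/eqP/negPn/negP => R0; have [c] := outermost_exists cupT RT R0.
by rewrite nout.
Qed.

Lemma surgeries_merged (nu : weight n) :
  surgeries #|T| (Stack S T S)
    [ffun o => (o == stack_orientation w mu : nat)] (stack_orientation nu nu) != 0%N ->
  forall s, s \in S -> merged s (nu s.1).
Proof.
move=> H s /mate_of[t tT <-].
case: (surgeries_partly_merged (subxx T) _ H) => [x|R' [_ cardR' [_ yR']]].
  rewrite ffunE eqb0 negbK => /eqP->; split=> t' t'T; rewrite ?t'T //.
  by rewrite !ffunE.
rewrite subnn leqn0 cards_eq0 in cardR'; have R'0 := eqP cardR'.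
have := yR' t tT; rewrite R'0 inE => /(_ isT).
by rewrite ffunE.
Qed.

End SmallCircles.

(** * Oriented circle diagrams *)

Section OrientedCups.
Variables (n : nat) (S : {set arc n}).
Hypothesis cupS : is_cup_diagram S.

(** Each arc carries each symbol at exactly one end, so both symbols occur [#|S|] times among the
    [2 * n] vertices. *)
Lemma oriented_is_weight (w : weight n) : oriented S w -> is_weight w.
Proof.
move=> /forall_inP Sw.
have card_end (b : bool) : #|[set i | w i == b]| = #|S|.
  pose f (c : arc n) := if w c.1 == b then c.1 else c.2.
  have fE c : is_end c (f c) by rewrite /f; case: ifP; rewrite ?is_end1 ?is_end2.
  have -> : [set i | w i == b] = f @: S.
    apply/setP => i; rewrite inE; apply/eqP/imsetP => [wi|[c cS ->]].
      have [c cS ci] := cup_cover cupS i; exists c => //.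
      have := Sw c cS; rewrite /f -wi; case/orP: ci => /eqP->; rewrite ?eqxx //.
      by move/negPf->.
    have := Sw c cS; rewrite /f; case: (eqVneq (w c.1) b) => // {f fE}.
    by case: (w c.1) (w c.2) (b) => [] [] [].
  rewrite card_in_imset // => c d cS dS cd.
  by apply: (cup_uniq cupS cS dS (fE c)); rewrite cd.
have cT := card_end true; have cF := card_end false.
have := cardsC [set i | w i == true]; rewrite cT.
rewrite (_ : ~: _ = [set i | w i == false]); last first.
  by apply/setP => i; rewrite !inE; case: (w i).
rewrite cF card_ord => S2; apply/eqP; rewrite (_ : [set i | w i] = [set i | w i == true]).
  by rewrite cT; lia.
by apply/setP => i; rewrite !inE; case: (w i).
Qed.

Lemma oriented_ext (w w' : weight n) : oriented S w -> oriented S w' ->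
  (forall c, c \in S -> w c.1 = w' c.1) -> w = w'.
Proof.
move=> /forall_inP Sw /forall_inP Sw' ww'; apply/ffunP => i.
have [c cS /orP[]/eqP->] := cup_cover cupS i; first exact: ww'.
have := Sw c cS; have := Sw' c cS; rewrite ww' //.
by case: (w' c.1) (w c.2) (w' c.2) => [] [] [].
Qed.

(** This weight makes all circles of [S] glued to its reflection anticlockwise. *)
Definition left_ends : weight n := [ffun i => [exists c in S, c.1 == i]].

Lemma left_ends1 c : c \in S -> left_ends c.1.
Proof. by move=> cS; rewrite ffunE; apply/exists_inP; exists c. Qed.

Lemma oriented_left_ends : oriented S left_ends.
Proof.
apply/forall_inP => c cS; rewrite left_ends1 // ffunE.
suff -> : [exists d in S, d.1 == c.2] = false by [].
apply/exists_inP => -[d dS /eqP dc]; have /eqP[] := cup_ends_neq cupS cS.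
rewrite -dc; congr (_.1); apply: (cup_uniq cupS cS dS (is_end2 c)).
by rewrite -dc is_end1.
Qed.

(* Reversing the orientation of one arc of S shows that both ends of an arc of T
   belong to the same arc of S. *)
Lemma same_arcs (T : {set arc n}) : is_cup_diagram T ->
  (forall w : weight n, oriented S w -> oriented T w) ->
  forall t, t \in T -> (t \in S) || (reverse t \in S).
Proof.
move=> cupT ST t tT; have [c cS ct] := cup_cover cupS t.1.
pose w := left_ends; pose w' : weight n := [ffun i => w i (+) is_end c i].
have w'E i : w' i = w i (+) is_end c i by rewrite ffunE.
have Sw' : oriented S w'.
  apply/forall_inP => d dS; have /forall_inP/(_ d dS) := oriented_left_ends.
  rewrite -/w !w'E; case: (eqVneq c d) => [->|cd].
    by rewrite is_end1 is_end2; case: (w d.1) (w d.2) => [] [].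
  have cdF i : is_end d i -> is_end c i = false.
    by move=> di; apply: contra_neqF cd => ci; exact: (cup_uniq cupS cS dS ci di).
  by rewrite !cdF ?is_end1 ?is_end2 // !addbF.
have /forall_inP/(_ t tT) := ST _ oriented_left_ends; rewrite -/w.
have /forall_inP/(_ t tT) := ST _ Sw'; rewrite !w'E ct => H1 H2.
have ct2 : is_end c t.2 by move: H1 H2; case: (w t.1) (w t.2) (is_end _ _) => [] [] [].
have := cup_ends_neq cupT tT.
case: t c ct ct2 cS {tT H1 H2 Sw' w'E w'} => [a b] [a' b']; rewrite /is_end /reverse /=.
case/orP=> /eqP-> /orP[]/eqP-> cS; rewrite ?eqxx // => _; by rewrite cS ?orbT.
Qed.

End OrientedCups.

Definition bottom n (x : circle_diagram n) := (val x).1.1.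
Definition top n (x : circle_diagram n) := (val x).2.
Definition wt n (x : circle_diagram n) := (val x).1.2.

Section CircleDiagrams.
Variable n : nat.
Implicit Types (x y z : circle_diagram n) (S T : {set arc n}).

Lemma circle_diagramP x :
  [&& is_weight (wt x), is_cup_diagram (bottom x), is_cup_diagram (top x),
      oriented (bottom x) (wt x) & oriented (top x) (wt x)].
Proof. by rewrite /bottom /top /wt; case: x => [[[B w] T]]. Qed.

Lemma cup_bottom x : is_cup_diagram (bottom x).
Proof. by have /and5P[] := circle_diagramP x. Qed.

Lemma cup_top x : is_cup_diagram (top x).
Proof. by have /and5P[] := circle_diagramP x. Qed.

Lemma oriented_bottom x : oriented (bottom x) (wt x).
Proof. by have /and5P[] := circle_diagramP x. Qed.

Lemma oriented_top x : oriented (top x) (wt x).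
Proof. by have /and5P[] := circle_diagramP x. Qed.

Lemma circle_diagram_eq x y :
  bottom x = bottom y -> wt x = wt y -> top x = top y -> x = y.
Proof.
move=> xyB xyw xyT; apply: val_inj; move: xyB xyw xyT; rewrite /bottom /top /wt.
by case: (val x) (val y) => [[? ?] ?] [[? ?] ?] /= -> -> ->.
Qed.

Lemma arc_coefficientE x y z : arc_coefficient x y z =
  if [&& top x == bottom y, bottom z == bottom x & top z == top y] then
    surgeries #|top x| (Stack (bottom x) (top x) (top y))
      [ffun o => (o == stack_orientation (wt x) (wt y) : nat)]
      (stack_orientation (wt z) (wt z))
  else 0%N.
Proof.
rewrite /arc_coefficient /bottom /top /wt.
by case: (val x) (val y) (val z) => [[? ?] ?] [[? ?] ?] [[? ?] ?].
Qed.

Lemma arc_coefficient_ends x y z : arc_coefficient x y z != 0%N ->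
  [/\ top x = bottom y, bottom z = bottom x & top z = top y].
Proof. by rewrite arc_coefficientE; case: and3P => // -[/eqP ? /eqP ? /eqP ?]. Qed.

Lemma arc_coefficient_merged x y z : arc_coefficient x y z != 0%N ->
  bottom x = top y ->
  (forall t, t \in top x -> (t \in bottom x) || (reverse t \in bottom x)) ->
  forall s, s \in bottom x -> merged (top x) (wt x) (wt y) s (wt z s.1).
Proof.
move=> + xy xST; rewrite arc_coefficientE; case: and3P => // _; rewrite -xy.
exact: surgeries_merged (cup_bottom x) (cup_top x) xST _ _ _.
Qed.

(** When bottom and top agree, this is the number of clockwise circles. *)
Definition degree x := #|[set s in bottom x | ~~ wt x s.1]|.

(** At each arc, [merged] excludes that both factors are clockwise, and makes the result clockwise
    as soon as one of them is. *)
Lemma arc_coefficient_degree x y z : arc_coefficient x y z != 0%N ->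
  bottom x = top x -> top y = top x -> (degree x + degree y <= degree z)%N.
Proof.
move=> xyz xx yx; have [xy zx _] := arc_coefficient_ends xyz.
have M s : s \in bottom x -> merged (top x) (wt x) (wt y) s (wt z s.1).
  apply: arc_coefficient_merged => //; first by rewrite xx yx.
  by move=> t; rewrite -xx => ->.
rewrite /degree zx -xy -xx -cardsUI.
rewrite (_ : _ :&: _ = set0) ?cards0 ?addn0; last first.
  apply/setP => s; rewrite !inE; case: (boolP (s \in bottom x)) => //= sx.
  have := M s sx; rewrite /merged -xx sx /= => /andP[_].
  by case: (wt x s.1) (wt y s.1) => [] [].
apply/subset_leq_card/subsetP => s; rewrite !inE -andb_orr => /andP[sx].
rewrite sx; have := M s sx; rewrite /merged -xx sx /=.
by case: (wt x s.1) (wt y s.1) (wt z s.1) => [] [] [].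
Qed.

Definition weights S T := [set w : weight n | oriented S w && oriented T w].

Lemma block_card S T : is_cup_diagram S -> is_cup_diagram T ->
  #|[pred x : circle_diagram n | (bottom x == S) && (top x == T)]| = #|weights S T|.
Proof.
move=> cupS cupT; rewrite -(card_in_image (f := @wt n)); last first.
  by move=> x y /andP[/eqP xS /eqP xT] /andP[/eqP yS /eqP yT] xy; apply: circle_diagram_eq; congruence.
apply: eq_card => w; rewrite inE; apply/imageP/andP => [[x /andP[/eqP<- /eqP<-] ->]|[Sw Tw]].
  by rewrite oriented_bottom oriented_top.
have P : is_circle_diagram (S, w, T).
  by rewrite /is_circle_diagram cupS cupT Sw Tw (oriented_is_weight cupS Sw).
by exists (Sub (S, w, T) P : circle_diagram n) => //; rewrite inE /bottom /top /= !eqxx.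
Qed.

Section Diagonal.
Variable S : {set arc n}.
Hypothesis cupS : is_cup_diagram S.

Lemma diagonal_subproof : is_circle_diagram (S, left_ends S, S).
Proof.
by rewrite /is_circle_diagram cupS oriented_left_ends // (oriented_is_weight cupS) ?oriented_left_ends.
Qed.

(** The only diagram of degree 0 on [S] and its reflection. *)
Definition diagonal : circle_diagram n := Sub (S, left_ends S, S) diagonal_subproof.

Lemma eq_diagonal x : bottom x = S -> top x = S ->
  (forall s, s \in S -> wt x s.1) -> x = diagonal.
Proof.
move=> xS xT xw; apply: circle_diagram_eq => //.
apply: (oriented_ext cupS); first by rewrite -xS oriented_bottom.
  exact: oriented_left_ends.
by move=> c cS; rewrite xw // [RHS](left_ends1 cS).
Qed.

Lemma degree_gt0 x : bottom x = S -> top x = S -> x != diagonal -> (0 < degree x)%N.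
Proof.
move=> xS xT; apply: contraNT; rewrite -leqNgt leqn0 cards_eq0 => /eqP/setP deg0.
apply/eqP/eq_diagonal => // s sS.
by have := deg0 s; rewrite !inE xS sS /= => /negbFE.
Qed.

(** By [merged], an anticlockwise circle in the product requires anticlockwise circles in both
    factors. *)
Lemma arc_coefficient_diagonal x y : arc_coefficient x y diagonal != 0%N ->
  top x = S -> x = diagonal /\ y = diagonal.
Proof.
move=> xyz xT; have [xy xS yT] := arc_coefficient_ends xyz.
have xS' : bottom x = S by rewrite -xS.
have yT' : top y = S by rewrite -yT.
have M s : s \in S -> wt x s.1 && wt y s.1.
  move=> sS; have xy' : bottom x = top y by rewrite xS' yT'.
  have xx t : t \in top x -> (t \in bottom x) || (reverse t \in bottom x).
    by rewrite xT xS' => ->.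
  have := arc_coefficient_merged xyz xy' xx; rewrite xS' => /(_ s sS)/andP[+ _].
  by rewrite [wt _ s.1](left_ends1 sS) => /and3P[_ -> ->].
by split; apply: eq_diagonal; rewrite -?xy // => s /M/andP[].
Qed.

End Diagonal.
End CircleDiagrams.

(** * The annular arc algebra *)

Section ArcAlgebra.
Variables (K : fieldType) (n : nat) (A : falgType K) (C : circle_diagram n -> A).
Hypothesis HC : annular_arc_algebra C.
Implicit Types (x y z : circle_diagram n) (S T : {set arc n}) (a b : A).

Definition coef z a : K := coord (codom_tuple C) (enum_rank z) a.

Lemma coefB z a b : coef z (a - b) = coef z a - coef z b.
Proof. exact: linearB. Qed.

Lemma coefZ z k a : coef z (k *: a) = k * coef z a.
Proof. exact: linearZ. Qed.

Lemma coef0 z : coef z 0 = 0.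
Proof. exact: linear0. Qed.

Lemma coef_sum z (I : finType) (P : pred I) (F : I -> A) :
  coef z (\sum_(i | P i) F i) = \sum_(i | P i) coef z (F i).
Proof. exact: linear_sum. Qed.

Let basisC : basis_of {:A}%VS (codom_tuple C) := HC.1.

Let nthC x : (codom_tuple C)`_(enum_rank x) = C x.
Proof. by rewrite /= (nth_image 0) enum_rankK. Qed.

Lemma coefC z x : coef z (C x) = (z == x)%:R.
Proof.
rewrite -nthC /coef coord_free ?(basis_free basisC) //.
by rewrite (inj_eq enum_rank_inj) eq_sym.
Qed.

Lemma coef_eq a : a = \sum_z coef z a *: C z.
Proof.
rewrite [LHS](coord_basis basisC) ?memvf //.
rewrite (reindex enum_rank) /=; last exact/onW_bij/enum_rank_bij.
by apply: eq_bigr => z _; rewrite -[in RHS]nthC.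
Qed.

Lemma coef_inj a b : (forall z, coef z a = coef z b) -> a = b.
Proof.
by move=> ab; rewrite [a]coef_eq [b]coef_eq; apply: eq_bigr => z _; rewrite ab.
Qed.

Lemma coefCM z x y : coef z (C x * C y) = (arc_coefficient x y z)%:R.
Proof.
rewrite HC.2 coef_sum (bigD1 z) //= big1 ?addr0 => [|u uz].
  by rewrite -scaler_nat coefZ coefC eqxx mulr1.
by rewrite -scaler_nat coefZ coefC eq_sym (negPf uz) mulr0.
Qed.

Lemma coefM z a b : coef z (a * b) =
  \sum_x \sum_y coef x a * coef y b * (arc_coefficient x y z)%:R.
Proof.
rewrite {1}[a]coef_eq {1}[b]coef_eq mulr_suml coef_sum; apply: eq_bigr => x _.
rewrite mulr_sumr coef_sum; apply: eq_bigr => y _.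
by rewrite -scalerAl coefZ -scalerAr coefZ coefCM mulrA.
Qed.

Lemma coefM_neq0 z a b : coef z (a * b) != 0 ->
  exists x y, [/\ coef x a != 0, coef y b != 0 & (arc_coefficient x y z)%:R != 0 :> K].
Proof.
pose P x y := [&& coef x a != 0, coef y b != 0 & (arc_coefficient x y z)%:R != 0 :> K].
move=> ab0; have /existsP[x /existsP[y /and3P[]]] : [exists x, exists y, P x y].
  apply: contraNT ab0 => /existsPn H.
  rewrite coefM big1 // => x _; rewrite big1 // => y _.
  have /existsPn/(_ y) := H x; rewrite !negb_and !negbK => /or3P[]/eqP->.
  - by rewrite !mul0r.
  - by rewrite mulr0 mul0r.
  - by rewrite mulr0.
by exists x, y.
Qed.

Lemma natr_neq0 (m : nat) : m%:R != 0 :> K -> m != 0%N.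
Proof. by apply: contraNneq => ->. Qed.

Definition block S T x := (bottom x == S) && (top x == T).

(* The component of 1 in the span of the diagrams with outer cup diagrams S, S:
   comparing components in 1 C_x = C_x = C_x 1 shows that it acts as a local
   unit, without computing any product. *)
Definition idem S : A := \sum_(x | block S S x) coef x 1 *: C x.

Lemma idemC S y : idem S * C y = if bottom y == S then C y else 0.
Proof.
have E z : coef z (idem S * C y) =
    \sum_(x | block S S x) coef x 1 * (arc_coefficient x y z)%:R.
  rewrite mulr_suml coef_sum; apply: eq_bigr => x _.
  by rewrite -scalerAl coefZ coefCM.
apply: coef_inj => z; rewrite E.
have ac0 x : ~~ [&& top x == bottom y, bottom z == bottom x & top z == top y] ->
    coef x 1 * (arc_coefficient x y z)%:R = 0.
  by rewrite arc_coefficientE => /negPf->; rewrite mulr0.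
case: (eqVneq (bottom y) S) => [yS|yS]; last first.
  rewrite coef0 big1 // => x /andP[_ /eqP xS].
  by rewrite ac0 // xS eq_sym (negPf yS).
case: (eqVneq (bottom z) S) => [zS|zS]; last first.
  rewrite coefC (_ : z == y = false); last by apply: contraNF zS => /eqP->; rewrite yS.
  by rewrite big1 // => x /andP[/eqP xS _]; rewrite ac0 // xS (negPf zS) andbF.
(* In [1 * C y], the components of 1 outside the block of [S], [S] cannot produce [z]. *)
rewrite -[in RHS](mul1r (C y)) {2}[1]coef_eq mulr_suml coef_sum.
rewrite [RHS](bigID (block S S)) /= [X in _ + X]big1 ?addr0 => [|x].
  by apply: eq_bigr => x _; rewrite -scalerAl coefZ coefCM.
rewrite -scalerAl coefZ coefCM => xS; apply: ac0; apply: contraNN xS.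
by rewrite yS zS /block => /and3P[/eqP-> /eqP<- _]; rewrite !eqxx.
Qed.

Lemma Cidem S y : C y * idem S = if top y == S then C y else 0.
Proof.
have E z : coef z (C y * idem S) =
    \sum_(x | block S S x) coef x 1 * (arc_coefficient y x z)%:R.
  rewrite mulr_sumr coef_sum; apply: eq_bigr => x _.
  by rewrite -scalerAr coefZ coefCM.
apply: coef_inj => z; rewrite E.
have ac0 x : ~~ [&& top y == bottom x, bottom z == bottom y & top z == top x] ->
    coef x 1 * (arc_coefficient y x z)%:R = 0.
  by rewrite arc_coefficientE => /negPf->; rewrite mulr0.
case: (eqVneq (top y) S) => [yS|yS]; last first.
  rewrite coef0 big1 // => x /andP[/eqP xS _].
  by rewrite ac0 // xS (negPf yS).
case: (eqVneq (top z) S) => [zS|zS]; last first.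
  rewrite coefC (_ : z == y = false); last by apply: contraNF zS => /eqP->; rewrite yS.
  by rewrite big1 // => x /andP[_ /eqP xS]; rewrite ac0 // xS (negPf zS) !andbF.
rewrite -[in RHS](mulr1 (C y)) {2}[1]coef_eq mulr_sumr coef_sum.
rewrite [RHS](bigID (block S S)) /= [X in _ + X]big1 ?addr0 => [|x].
  by apply: eq_bigr => x _; rewrite -scalerAr coefZ coefCM.
rewrite -scalerAr coefZ coefCM => xS; apply: ac0; apply: contraNN xS.
by rewrite yS zS /block => /and3P[/eqP<- _ /eqP<-]; rewrite !eqxx.
Qed.

Lemma sandwich_eq u a v : u * a * v = \sum_x coef x a *: (u * C x * v).
Proof.
rewrite {1}[a]coef_eq mulr_sumr mulr_suml; apply: eq_bigr => x _.
by rewrite -scalerAr -scalerAl.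
Qed.

Lemma coef_block z S T a :
  coef z (idem S * a * idem T) = if block S T z then coef z a else 0.
Proof.
have E x : coef z (coef x a *: (idem S * C x * idem T)) =
    if block S T x then coef x a * (z == x)%:R else 0.
  rewrite idemC /block coefZ; case: eqP => _ /=; last by rewrite mul0r coef0 mulr0.
  by rewrite Cidem; case: eqP => _; rewrite ?coefC // coef0 mulr0.
rewrite sandwich_eq coef_sum (bigD1 z) //= E eqxx mulr1 big1 ?addr0 // => x xz.
by rewrite E eq_sym (negPf xz) mulr0 if_same.
Qed.

Lemma idem_orth S T : idem S * idem T = if S == T then idem S else 0.
Proof.
rewrite {2}/idem mulr_sumr; case: eqVneq => [->|ST].
  by apply: eq_bigr => x /andP[/eqP xT _]; rewrite -scalerAr idemC xT eqxx.
rewrite big1 // => x /andP[/eqP xT _].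
by rewrite -scalerAr idemC xT eq_sym (negPf ST) scaler0.
Qed.

Let cups := {S : {set arc n} | is_cup_diagram S}.

Lemma idem_sum : \sum_(S : cups) idem (val S) = 1.
Proof.
rewrite -[LHS]mulr1 [in LHS](coef_eq 1) [RHS](coef_eq 1) mulr_sumr.
apply: eq_bigr => y _; rewrite -scalerAr mulr_suml; congr (_ *: _).
pose S0 : cups := Sub (bottom y) (cup_bottom y).
rewrite (bigD1 S0) //= idemC eqxx big1 ?addr0 // => S SS0.
rewrite idemC ifF //; apply: contraNF SS0 => /eqP yS.
by apply/eqP/val_inj; rewrite /= yS.
Qed.

Definition block_space S T : {vspace A} := <<[seq C x | x <- enum (block S T)]>>%VS.

Lemma span_sandwich (u v : A) (X : seq A) :
  (forall b, b \in X -> u * b * v = b) ->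
  forall a, a \in <<X>>%VS -> u * a * v = a.
Proof.
move=> uXv a /(@coord_span _ _ _ (in_tuple X)) ->.
rewrite mulr_sumr mulr_suml; apply: eq_bigr => i _.
by rewrite -scalerAr -scalerAl uXv // mem_nth.
Qed.

Lemma mem_block_space S T a : (a \in block_space S T) = (idem S * a * idem T == a).
Proof.
apply/idP/eqP => [|<-].
  apply: span_sandwich => _ /mapP[x + ->]; rewrite mem_enum => /andP[/eqP xS /eqP xT].
  by rewrite idemC xS eqxx Cidem xT eqxx.
rewrite [_ * _ * _]coef_eq; apply: memv_suml => x _; rewrite coef_block.
case: ifP => xST; last by rewrite scale0r mem0v.
by apply/memvZ/memv_span/map_f; rewrite mem_enum.
Qed.

Lemma dim_block_space S T : is_cup_diagram S -> is_cup_diagram T ->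
  \dim (block_space S T) = #|weights S T|.
Proof.
move=> cupS cupT; rewrite -block_card //.
have free_block : free [seq C x | x <- enum (block S T)].
  have : free (codom C) by exact: basis_free basisC.
  (* Listing the block first makes it a prefix of a free family. *)
  rewrite codomE -(perm_free (perm_map C (permEl (perm_filterC (block S T) (enum _))))).
  rewrite map_cat => /catl_free.
  by rewrite {1}enumT /enum_mem.
rewrite (eqP free_block) size_map -cardE.
by apply: eq_card => x.
Qed.

(** * Locality of the diagonal blocks and their characters *)

Section LocalBlock.
Variable S : {set arc n}.
Hypothesis cupS : is_cup_diagram S.
Let d := diagonal cupS.

Let blockP a x : idem S * a * idem S = a -> coef x a != 0 ->
  bottom x = S /\ top x = S.
Proof.
by move=> <-; rewrite coef_block /block; case: andP => [[/eqP ? /eqP ?]|]; rewrite ?eqxx.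
Qed.

Let idemSS : idem S * idem S = idem S.
Proof. by rewrite idem_orth eqxx. Qed.

(** Without a component at [d], all diagrams in [a] have positive degree, so those in [a ^+ k.+1]
    have degree above [k], whereas degrees are at most [#|S|]. *)
Lemma block_nilpotent a :
  idem S * a * idem S = a -> coef d a = 0 -> exists N, a ^+ N = 0.
Proof.
move=> aS ad; have deg1 x : coef x a != 0 ->
    [/\ bottom x = S, top x = S & (0 < degree x)%N].
  move=> xa; have [xS xT] := blockP aS xa; split=> //.
  by apply: (degree_gt0 (cupS := cupS)) => //; apply: contraNneq xa => ->; rewrite ad.
have deg k x : coef x (a ^+ k.+1) != 0 ->
    [/\ bottom x = S, top x = S & (k < degree x)%N].
  elim: k x => [|k IHk] x; first by rewrite expr1; exact: deg1.
  rewrite exprSr => /coefM_neq0[y [z [/IHk[yS yT yk] /deg1[zS zT z0] /natr_neq0 yzx]]].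
  have [_ xS xT] := arc_coefficient_ends yzx.
  rewrite xS xT; split=> //; apply: leq_trans (arc_coefficient_degree yzx _ _).
  - by rewrite -[k.+2]addn1 leq_add.
  - by rewrite yS yT.
  - by rewrite zT yT.
exists #|S|.+1; apply: coef_inj => x; rewrite coef0.
apply/eqP/negPn/negP => /deg[xS _]; rewrite ltnNge /degree xS => /negP[].
by apply/subset_leq_card/subsetP => s; rewrite inE => /andP[].
Qed.

(** This coefficient is never computed: [coef_diagonal_idem] shows that it is invertible, and it
    serves to normalise [coef d]. *)
Let c0 := coef d (C d * C d).

(** By [arc_coefficient_diagonal] only the pair [d], [d] contributes. The assumption is clear when
    [a] lies in the block, and [coefCM_diagonal] extends it to all of [A]. *)
Lemma coef_diagonalM a b :
  (forall x y, coef x a != 0 -> coef y b != 0 ->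
     (arc_coefficient x y d)%:R != 0 :> K -> top x = S) ->
  coef d (a * b) = c0 * coef d a * coef d b.
Proof.
move=> abS; rewrite coefM.
have E x y : coef x a * coef y b * (arc_coefficient x y d)%:R =
    if (x == d) && (y == d) then c0 * coef d a * coef d b else 0.
  case: andP => [[/eqP-> /eqP->]|xyd].
    by rewrite /c0 coefCM mulrC mulrA.
  apply/eqP; rewrite !mulf_eq0 -orbA; apply/or3P.
  case: (eqVneq (coef x a) 0) => [|xa]; first by constructor 1.
  case: (eqVneq (coef y b) 0) => [|yb]; first by constructor 2.
  constructor 3; apply/negPn/negP => xyd0; apply: xyd.
  have [] := arc_coefficient_diagonal (natr_neq0 xyd0) (abS _ _ xa yb xyd0).
  by move=> -> ->; rewrite !eqxx.
under eq_bigr => x _ do under eq_bigr => y _ do rewrite E.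
have sum_d (F : K) : \sum_x (if x == d then F else 0) = F.
  by rewrite -big_mkcond big_pred1_eq.
rewrite (eq_bigr (fun x => if x == d then c0 * coef d a * coef d b else 0)) ?sum_d // => x _.
by case: (x == d); rewrite /= ?sum_d // big1.
Qed.

Lemma coef_diagonal_idem : c0 * coef d (idem S) = 1.
Proof.
have dd : coef d (idem S * C d) = 1 by rewrite idemC eqxx coefC eqxx.
rewrite -[RHS]dd coef_diagonalM ?coefC ?eqxx ?mulr1 // => x y xS _ _.
have [] // : bottom x = S /\ top x = S.
by apply: blockP xS; rewrite -mulrA !idemSS.
Qed.

Lemma diagonal_neq0 : c0 != 0.
Proof.
by apply/eqP => c00; have := coef_diagonal_idem; rewrite c00 mul0r => /esym/eqP; rewrite oner_eq0.
Qed.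

Lemma block_inverse u : idem S * u * idem S = u -> coef d u != 0 ->
  exists v, u * v = idem S.
Proof.
(* With this scaling [k *: u] and [idem S] have the same coefficient at [d], so their difference is
   nilpotent. *)
move=> uS u0; pose k := (c0 * coef d u)^-1.
have [||N tN] := @block_nilpotent (idem S - k *: u).
- by rewrite mulrBr mulrBl !idemSS -scalerAr -scalerAl uS.
- rewrite coefB coefZ /k invfM -mulrA mulVf // mulr1.
  by rewrite -[c0^-1]mulr1 -coef_diagonal_idem mulKf ?diagonal_neq0 ?subrr.
have [|v [uv _]] := corner_inverse idemSS _ tN.
  by rewrite mulrBr mulrBl !idemSS -scalerAr -scalerAl uS.
exists (k *: v); rewrite -scalerAr scalerAl -[in RHS]uv; congr (_ * _).
by rewrite opprB addrC subrK.
Qed.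

(* If a product of A_{S,T} and A_{T,S} is invertible in A_{S,S}, then
   dim A_{S,S} <= dim A_{S,T}, so S and T consist of arcs with the same ends and
   all circles occurring in the product are small. *)
Lemma coefCM_diagonal x y : (arc_coefficient x y d)%:R != 0 :> K -> top x = S.
Proof.
move=> xyd; have [xy xS yS] := arc_coefficient_ends (natr_neq0 xyd).
have {}xS : bottom x = S by rewrite -xS.
have {}yS : top y = S by rewrite -yS.
have [||v uv] := @block_inverse (C x * C y).
- by rewrite mulrA idemC xS eqxx -mulrA Cidem yS eqxx.
- by rewrite coefCM.
set T := top x in xy *; have cupT : is_cup_diagram T := cup_top x.
(* Right multiplication by [C x] is injective on the block of [S], [S], being undone by right
   multiplication by [C y * v]. *)
have dimle : (\dim (block_space S S) <= \dim (block_space S T))%N.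
  have <- : \dim (amulr (C x) @: block_space S S) = \dim (block_space S S).
    apply: limg_dim_eq; apply/eqP; rewrite -subv0; apply/subvP => a.
    rewrite memv_cap mem_block_space memv_ker lfunE /= => /andP[/eqP aS /eqP ax0].
    have <- : a * idem S = a by rewrite -aS -!mulrA idemSS.
    by rewrite -uv !mulrA ax0 !mul0r mem0v.
  apply/dimvS/subvP => _ /memv_imgP[a + ->]; rewrite !mem_block_space lfunE /=.
  move=> /eqP aS; rewrite -!mulrA Cidem eqxx mulrA; apply/eqP; congr (_ * _).
  by rewrite -aS !mulrA idemSS.
(* The weights orienting both [S] and [T] are among those orienting [S]; the dimensions show that
   they are all of them. *)
have ST w : oriented S w -> oriented T w.
  move=> Sw; have /setP/(_ w) : weights S T = weights S S.
    apply/eqP; rewrite eqEcard -!dim_block_space // dimle andbT.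
    by apply/subsetP => w'; rewrite !inE => /andP[->].
  by rewrite !inE Sw => /= ->.
(* All circles of [d] are anticlockwise, which [merged] allows only at arcs common to [S] and
   [T]. *)
have M s : s \in S -> s \in T.
  move=> sS; have xy' : bottom x = top y by rewrite xS yS.
  have arcs : forall t, t \in top x -> (t \in bottom x) || (reverse t \in bottom x).
    by rewrite xS; apply: same_arcs.
  have := arc_coefficient_merged (natr_neq0 xyd) xy' arcs; rewrite xS => /(_ s sS)/andP[+ _].
  by rewrite [wt _ s.1](left_ends1 sS) => /and3P[].
apply/setP => t; apply/idP/idP => [tT|]; last exact: M.
have [s sS st] := cup_cover cupS t.1.
by rewrite -(cup_uniq cupT (M s sS) tT st (is_end1 t)).
Qed.

(** The residue map of the local ring [e_S A e_S], composed with the projection of [A] onto it. It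
    is multiplicative on [A] because products through another cup diagram have no component at
    [d]. *)
Definition char a : K := c0 * coef d a.

Lemma char_zmod_morphism : zmod_morphism char.
Proof. by move=> a b; rewrite /char coefB mulrBr. Qed.

Lemma coef_diagonal1 a : coef d (idem S * a * idem S) = coef d a.
Proof. by rewrite coef_block /block !eqxx. Qed.

Lemma char_idem : char (idem S) = 1.
Proof. exact: coef_diagonal_idem. Qed.

Lemma char_monoid_morphism : monoid_morphism char.
Proof.
split=> [|a b]; first by rewrite /char -coef_diagonal1 mulr1 idemSS coef_diagonal_idem.
rewrite /char coef_diagonalM => [|x y _ _]; last exact: coefCM_diagonal.
by rewrite !mulrA [c0 * _ * c0]mulrAC.
Qed.

HB.instance Definition _ := GRing.isZmodMorphism.Build A K char char_zmod_morphism.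
HB.instance Definition _ := GRing.isMonoidMorphism.Build A K char char_monoid_morphism.

Lemma charZ k : char k%:A = k.
Proof. by rewrite /char coefZ mulrCA -[c0 * _]/(char 1) rmorph1 mulr1. Qed.

Lemma char_nilpotent a :
  idem S * a * idem S = a -> char a = 0 -> exists N, a ^+ N = 0.
Proof.
move=> aS /eqP; rewrite mulf_eq0 (negPf diagonal_neq0) => /eqP.
exact: block_nilpotent.
Qed.

End LocalBlock.

Lemma cartan_matrix_weights m (M : 'M[int]_m) : is_cartan_matrix A M ->
  exists phi : 'I_m -> cups,
    (forall i j, M i j = #|weights (val (phi j)) (val (phi i))|%:Z) /\
    forall S : cups, exists i, phi i = S.
Proof.
move=> HM.
have orth (S T : cups) : idem (val S) * idem (val T) = if S == T then idem (val S) else 0.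
  by rewrite idem_orth.
have [phi [phiM phis]] := cartan_matrix_dim orth idem_sum
  (eps := fun S : cups => char (valP S) : {rmorphism A -> K})
  (fun S : cups => charZ (valP S)) (fun S : cups => char_idem (valP S))
  (fun S : cups => @char_nilpotent _ (valP S))
  (fun S T : cups => mem_block_space (val S) (val T)) HM.
by exists phi; split=> // i j; rewrite phiM dim_block_space ?(valP (phi _)).
Qed.

End ArcAlgebra.

(** * Cup diagrams matching the same pairs of vertices *)

Section NestedArcs.
Variable n : nat.

(* The vertices i and 2n - 1 - i are joined; [left] selects the left end of each
   arc, i.e. whether it is staying or wrapping. *)
Definition nested_arcs (left : pred nat) : {set arc n} :=
  [set c | (c.2 == rev_ord c.1) && left c.1].

Definition chooses_end (left : pred nat) :=
  forall i, (i < 2 * n)%N -> left i (+) left (2 * n - i.+1)%N.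

(** Orientation depends only on the unordered pairs of matched vertices, which do not depend on
    [left]. *)
Lemma oriented_nested_arcs left left' w : chooses_end left -> chooses_end left' ->
  oriented (nested_arcs left) w -> oriented (nested_arcs left') w.
Proof.
move=> L L' /forall_inP Lw; apply/forall_inP => -[a b]; rewrite inE /= => /andP[/eqP-> _].
have := L a (ltn_ord a); case: (boolP (left a)) => [la _|_ /= lr].
  by have := Lw (a, rev_ord a); rewrite inE eqxx => /(_ la).
by have := Lw (rev_ord a, a); rewrite inE /= rev_ordK eqxx eq_sym => /(_ lr).
Qed.

(** All arcs are staying, hence nested, except possibly the one from the last vertex to the first;
    its interval is the single segment around the back, disjoint from all staying intervals. *)
Lemma nested_arcs_cup_diagram left : chooses_end left ->
  (forall i, left i -> (i < n)%N || (i == (2 * n).-1)) ->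
  is_cup_diagram (nested_arcs left).
Proof.
move=> L Ln; apply/and3P; split.
- apply/forall_inP => -[a b]; rewrite inE /= => /andP[/eqP-> _].
  apply/eqP => /(congr1 val)/=; have := ltn_ord a; lia.
- apply/forallP => i; apply/cards1P.
  exists (if left i then (i, rev_ord i) else (rev_ord i, i)).
  apply/setP => -[a b]; rewrite !inE /=; have := L i (ltn_ord i).
  case: (boolP (left i)) => /= li; rewrite ?addTb ?addFb => lr.
    rewrite xpair_eqE; apply/idP/andP => [/andP[/andP[/eqP-> la] /orP[/eqP->|/eqP iE]]|[/eqP-> /eqP->]].
    - by rewrite eqxx.
    - move: lr; rewrite iE (_ : (2 * n - (rev_ord a).+1)%N = a) ?la //.
      by rewrite /=; have := ltn_ord a; lia.
    - by rewrite !eqxx li.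
  rewrite xpair_eqE; apply/idP/andP => [/andP[/andP[/eqP-> la] /orP[/eqP iE|/eqP->]]|[/eqP-> /eqP->]].
  - by rewrite iE la in li.
  - by rewrite rev_ordK eqxx.
  - by rewrite rev_ordK !eqxx lr orbT.
- apply/forall_inP => -[a b]; rewrite inE /= => /andP[/eqP-> la].
  apply/forall_inP => -[a' b']; rewrite inE /= => /andP[/eqP-> la'].
  have staying (c i : vertex n) : (c < n)%N ->
      (i \in interval (c, rev_ord c)) = (c <= i < 2 * n - c.+1)%N.
    by move=> cn; rewrite inE /wrapping /= ifF //; apply/negbTE; lia.
  have outer (c i : vertex n) : c = (2 * n).-1 :> nat ->
      (i \in interval (c, rev_ord c)) = (i == c).
    move=> cn; rewrite inE /wrapping /= -(inj_eq val_inj) /= ifT; have := ltn_ord i; lia.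
  have sub (c c' : vertex n) : (c < n)%N -> (c' <= c)%N ->
      interval (c, rev_ord c) \subset interval (c', rev_ord c').
    by move=> cn cc; apply/subsetP => i; rewrite !staying //; lia.
  have disj (c c' : vertex n) : (c < n)%N -> c' = (2 * n).-1 :> nat ->
      [disjoint interval (c, rev_ord c) & interval (c', rev_ord c')].
    move=> cn cc; apply/pred0P => i /=; rewrite staying // outer //.
    by apply/andP => -[ci /eqP iE]; move: ci; rewrite iE cc; lia.
  case/orP: (Ln _ la) => [an|/eqP an]; case/orP: (Ln _ la') => [an'|/eqP an'].
  - by case/orP: (leq_total a a') => aa; rewrite (sub _ _ _ aa) ?orbT.
  - by rewrite disj.
  - by rewrite disjoint_sym disj.
  - by rewrite (_ : a = a') ?subxx ?orbT //; apply: val_inj; rewrite /= an.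
Qed.

End NestedArcs.

(** * Gram matrices and the determinant *)

Lemma positive_semidefinite_gram m (I : finType) (O : 'I_m -> I -> bool) (M : 'M[int]_m) :
  (forall i j, M i j = #|[set k | O j k && O i k]|%:Z) -> positive_semidefinite M.
Proof.
move=> ME; split; first by apply/matrixP => i j; rewrite mxE !ME; congr Posz; apply: eq_card => k; rewrite !inE andbC.
move=> R x.
(* [M] is the Gram matrix of the 0-1 vectors [O i], so its quadratic form is a sum of squares. *)
have -> : (x^T *m map_mx intr M *m x) 0 0 =
    \sum_k (\sum_i (O i k)%:R * x i 0) ^+ 2.
  rewrite mxE; under eq_bigr => j _ do rewrite mxE mulr_suml.
  under [RHS]eq_bigr => k _ do rewrite expr2 mulr_suml.
  rewrite [RHS]exchange_big [LHS]exchange_big /=; apply: eq_bigr => i _.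
  under [RHS]eq_bigr => k _ do rewrite mulr_sumr.
  rewrite [RHS]exchange_big /=; apply: eq_bigr => j _.
  rewrite !mxE ME -sum1dep_card -pmulrn natr_sum big_mkcond /=.
  rewrite mulr_sumr mulr_suml; apply: eq_bigr => k _.
  by case: (O j k); case: (O i k); rewrite /= ?(mulr1, mul1r, mul0r, mulr0).
by apply: sumr_ge0 => k _; exact: sqr_ge0.
Qed.

Theorem proposition5p21 (K : fieldType) (n : nat) (A : falgType K)
    (C : circle_diagram n -> A) (m : nat) (M : 'M[int]_m) :
  (1 <= n)%N ->
  annular_arc_algebra C ->
  is_cartan_matrix A M ->
  positive_semidefinite M /\ \det M = 0.
Proof.
move=> n1 HC HM; have [phi [phiM phis]] := cartan_matrix_weights HC HM.
split.
  apply: (@positive_semidefinite_gram _ _ (fun i w => oriented (val (phi i)) w)).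
  exact: phiM.
(* With [l1] all nested arcs are staying; [l2] starts the outer one at the last vertex instead, so
   that it wraps. *)
pose l1 : pred nat := fun i => (i < n)%N.
pose l2 : pred nat := fun i => (0 < i < n)%N || (i == (2 * n).-1).
have L1 : chooses_end n l1 by move=> i; rewrite /l1; lia.
have L2 : chooses_end n l2 by move=> i; rewrite /l2; lia.
have cup1 : is_cup_diagram (nested_arcs n l1).
  by apply: nested_arcs_cup_diagram => // i; rewrite /l1 => ->.
have cup2 : is_cup_diagram (nested_arcs n l2).
  by apply: nested_arcs_cup_diagram => // i; rewrite /l2 => /orP[/andP[_ ->]|->]; rewrite ?orbT.
have [i1 phi1] := phis (Sub (nested_arcs n l1) cup1).
have [i2 phi2] := phis (Sub (nested_arcs n l2) cup2).
apply: (@determinant_alternate _ _ M i1 i2).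
  apply: contraTneq isT => i12; move: phi2; rewrite -i12 phi1 => /(congr1 val)/=/setP.
  have n0 : (0 < 2 * n)%N by lia.
  (* The outer staying arc belongs to the first diagram only. *)
  move/(_ (Ordinal n0, rev_ord (Ordinal n0))); rewrite !inE eqxx /l1 /l2 /= n1.
  by have -> : (0 == (2 * n).-1)%N = false by lia.
move=> j; rewrite !phiM phi1 phi2 /=; congr Posz; apply: eq_card => w; rewrite !inE.
by congr (_ && _); apply/idP/idP; apply: oriented_nested_arcs.
Qed.
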